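(* Let $f,\hat f:\mathbb{R}^d\to\mathbb{R}^d$ be sufficiently smooth vector fields, with Jacobians $J,\hat J$, Hessian tensors $\mathcal{H},\hat{\mathcal{H}}$ and third-derivative tensors $\mathcal{T},\hat{\mathcal{T}}$, and let $\Delta J(u)=\hat J(u)-J(u)$, $\Delta\mathcal{H}(u)=\hat{\mathcal{H}}(u)-\mathcal{H}(u)$, $\Delta\mathcal{T}(u)=\hat{\mathcal{T}}(u)-\mathcal{T}(u)$ for $u\in\mathbb{R}^d$. For $\varepsilon\sim\mathcal{N}(0,\eta^2 I_d)$, the randomized Jacobian mismatch satisfies $$ \mathbb{E}_{\varepsilon}\left[\|\Delta J(u+\varepsilon)\|_F^2\right] =\|\Delta J(u)\|_F^2 +\eta^2\,\|\Delta \mathcal{H}(u)\|_F^2 +\eta^2\sum_{i,\ell} \Delta J_{i\ell}(u)\,\operatorname{tr}\big(\Delta\mathcal{T}_{i\ell}(u)\big) +\mathcal{R}_\eta, $$ where $\mathcal{R}_\eta$ collects higher-order terms in the perturbation scale. (The first term on the right is the Jacobian mismatch and the second is the implicit Hessian mismatch.)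
   Context: Here $f=(f_1,\dots,f_d)$ is the true vector field of an ODE $du/dt=f(u)$ on $\mathbb{R}^d$, and $\hat f=(\hat f_1,\dots,\hat f_d)$ is a learned vector field (a neural network with parameters $\theta$, with derivatives taken with respect to the state $u$). The number $\eta>0$ is the noise level (perturbation scale), $\varepsilon$ is a Gaussian random vector in $\mathbb{R}^d$ with mean zero and covariance $\eta^2 I_d$, and $\mathbb{E}_\varepsilon$ is expectation over $\varepsilon$. Jacobians: $J_{i\ell}(u)=\dfrac{\partial f_i}{\partial u_\ell}(u)$ and $\hat J_{i\ell}(u)=\dfrac{\partial \hat f_i}{\partial u_\ell}(u)$. Hessian tensors: $\mathcal{H}_{ijk}(u)=\dfrac{\partial^2 f_i}{\partial u_j\,\partial u_k}(u)$ and $\hat{\mathcal{H}}_{ijk}(u)=\dfrac{\partial^2 \hat f_i}{\partial u_j\,\partial u_k}(u)$. Third-derivative tensors: $\mathcal{T}_{i\ell jk}(u)=\dfrac{\partial^3 f_i}{\partial u_\ell\,\partial u_j\,\partial u_k}(u)$ and $\hat{\mathcal{T}}_{i\ell jk}(u)=\dfrac{\partial^3 \hat f_i}{\partial u_\ell\,\partial u_j\,\partial u_k}(u)$. Norms and traces: $\|A\|_F^2=\sum_{i,\ell}A_{i\ell}^2$ for matrices, $\|\mathcal{A}\|_F^2=\sum_{i,j,k}\mathcal{A}_{ijk}^2$ for third-order tensors, and $\operatorname{tr}(\Delta\mathcal{T}_{i\ell}(u))=\sum_{j}\Delta\mathcal{T}_{i\ell jj}(u)$ is the partial trace over the last two indices.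 All indices run from $1$ to $d$.
   Formalization: The expectation of the squared Jacobian mismatch is assumed finite at one noise level η0, and the identity is for 0 < η ≤ η0; without this it fails (d = 1, f = 0, f̂' = exp(x⁴)). ''Higher-order terms'' is read as o(η²), and ''sufficiently smooth'' as C³. *)

(* Defs.v *)
From HB Require Import structures.
From mathcomp Require Import all_boot all_order all_algebra.
From mathcomp Require Import all_classical all_reals all_analysis.

Set Implicit Arguments.
Unset Strict Implicit.
Unset Printing Implicit Defensive.

Import Order.TTheory GRing.Theory Num.Theory.
Import numFieldNormedType.Exports.

Local Open Scope classical_set_scope.
Local Open Scope ring_scope.

Definition partial (R : realType) (d : nat) (l : 'I_d) (g : 'rV[R]_d -> R) :
  'rV[R]_d -> R := fun u => 'D_(delta_mx 0 l : 'rV[R]_d) g u.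

Fixpoint class_C (R : realType) (d k : nat) (g : 'rV[R]_d -> R) : Prop :=
  match k with
  | 0 => continuous g
  | k'.+1 => continuous g /\
      forall l : 'I_d,
        (forall u, derivable g u (delta_mx 0 l : 'rV[R]_d)) /\
        class_C k' (partial l g)
  end.

Definition comp_field (R : realType) (d : nat) (f : 'rV[R]_d -> 'rV[R]_d)
  (i : 'I_d) : 'rV[R]_d -> R := fun u => f u 0 i.

Definition field_class_C (R : realType) (d k : nat)
  (f : 'rV[R]_d -> 'rV[R]_d) : Prop :=
  forall i : 'I_d, class_C k (comp_field f i).

(* The library's ['J f u] is the transpose of this matrix (it acts on row
   vectors). *)
Definition jac (R : realType) (d : nat) (f : 'rV[R]_d -> 'rV[R]_d)
  (u : 'rV[R]_d) : 'M[R]_d :=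
  \matrix_(i, l) partial l (comp_field f i) u.

Definition hess (R : realType) (d : nat) (f : 'rV[R]_d -> 'rV[R]_d)
  (u : 'rV[R]_d) (i j k : 'I_d) : R :=
  partial j (partial k (comp_field f i)) u.

Definition third (R : realType) (d : nat) (f : 'rV[R]_d -> 'rV[R]_d)
  (u : 'rV[R]_d) (i l j k : 'I_d) : R :=
  partial l (partial j (partial k (comp_field f i))) u.

Definition delta_jac (R : realType) (d : nat) (f fhat : 'rV[R]_d -> 'rV[R]_d)
  (u : 'rV[R]_d) : 'M[R]_d := jac fhat u - jac f u.

Definition delta_hess (R : realType) (d : nat) (f fhat : 'rV[R]_d -> 'rV[R]_d)
  (u : 'rV[R]_d) (i j k : 'I_d) : R := hess fhat u i j k - hess f u i j k.

Definition delta_third (R : realType) (d : nat) (f fhat : 'rV[R]_d -> 'rV[R]_d)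
  (u : 'rV[R]_d) (i l j k : 'I_d) : R :=
  third fhat u i l j k - third f u i l j k.

(* Squared Frobenius norms; the library's norm [`|A|] on matrices is the max
   norm. *)
Definition frob2 (R : realType) (d : nat) (A : 'M[R]_d) : R :=
  \sum_(i < d) \sum_(l < d) A i l ^+ 2.

Definition frob2_tensor3 (R : realType) (d : nat)
  (A : 'I_d -> 'I_d -> 'I_d -> R) : R :=
  \sum_(i < d) \sum_(j < d) \sum_(k < d) A i j k ^+ 2.

Definition tr_last2 (R : realType) (d : nat)
  (A : 'I_d -> 'I_d -> 'I_d -> 'I_d -> R) (i l : 'I_d) : R :=
  \sum_(j < d) A i l j j.

Definition mutually_independent (R : realType) (disp : measure_display)
  (T : measurableType disp) (P : probability T R) (d : nat)
  (X : 'I_d -> {RV P >-> R}) : Prop :=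
  forall (I : {set 'I_d}) (A : 'I_d -> set R), (forall i, measurable (A i)) ->
    P [set w | forall i, i \in I -> A i (X i w)] =
      (\prod_(i in I) P (X i @^-1` A i))%E.

(* X ~ N(0, eta^2 I_d): since the covariance is a multiple of the identity,
   this is a vector of independent N(0, eta^2) coordinates.  The second argument
   of [normal_prob] is the standard deviation. *)
Definition isotropic_gaussian (R : realType) (disp : measure_display)
  (T : measurableType disp) (P : probability T R) (d : nat)
  (X : 'I_d -> {RV P >-> R}) (eta : R) : Prop :=
  mutually_independent X /\
  forall (i : 'I_d) (A : set R), measurable A ->
    distribution P (X i) A = normal_prob 0 eta A.

Definition rvec (R : realType) (disp : measure_display)
  (T : measurableType disp) (P : probability T R) (d : nat)
  (X : 'I_d -> {RV P >-> R}) (w : T) : 'rV[R]_d := \row_i X i w.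

(* Main.v *)
Require Import Defs.
From HB Require Import structures.
From mathcomp Require Import all_boot all_order all_algebra.
From mathcomp Require Import all_classical all_reals all_analysis.
From mathcomp Require Import measurable_realfun ring lra.

Set Implicit Arguments.
Unset Strict Implicit.
Unset Printing Implicit Defensive.

Import Order.TTheory GRing.Theory Num.Theory.
Import numFieldNormedType.Exports.

Local Open Scope classical_set_scope.
Local Open Scope ring_scope.

(* The squared mismatch G = ||Delta J||_F^2 is a nonnegative C^2 function.  By the
   second-order Taylor formula at u it equals, up to e * |x|^2 near 0, a quadratic
   polynomial q whose Gaussian mean is G(u) + eta^2 * (Laplacian of G at u) / 2;
   the Laplacian is the Hessian term plus the trace term, after commuting partial
   derivatives.  Away from 0, the law of N(0, eta^2 I) is at most
   (eta0/eta)^d exp(-r^2/2 (eta^-2 - eta0^-2)) times that of N(0, eta0^2 I) on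
   each slab r <= |x_k|, so the only integrability needed is the one at eta0, and
   the far part of E|G - q| is smaller than any power of eta.
   Two random vectors are compared through boxes only: a continuous function is
   the limit of its infima over the cells of finer and finer finite partitions of
   R^d into boxes, and Fatou's lemma turns an inequality between the probabilities
   of boxes into one between integrals.  Symmetry of boxes under a sign change of
   one coordinate likewise yields the vanishing of the odd moments. *)

(** * Mean value theorem and symmetry of second derivatives *)

Section calculus.
Context {R : realType} {d : nat}.
Implicit Types (g h : 'rV[R]_d -> R) (u v x : 'rV[R]_d).

Local Notation e_ l := (delta_mx 0 l : 'rV[R]_d).

Lemma coord_le_norm v i : `|v 0 i| <= `|v|.
Proof.
rewrite -[leRHS]/(mx_norm v) mx_normrE.
by rewrite (bigmaxD1 (0, i))//= le_max lexx.
Qed.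

Lemma norm_le_coord v (r : R) : 0 <= r -> (forall i, `|v 0 i| <= r) -> `|v| <= r.
Proof.
move=> r0 vr; rewrite -[leLHS]/(mx_norm v) mx_normrE.
by apply/bigmax_leP; split => // -[i j] _ /=; rewrite ord1.
Qed.

(** The two difference quotients are the same function of the increment; this opens partial
    derivatives to the one-variable mean value theorem. *)
Lemma is_derive_line g (l : 'I_d) v (t : R) :
  derivable g (v + t *: e_ l) (e_ l) ->
  is_derive t 1 (fun s : R => g (v + s *: e_ l)) (partial l g (v + t *: e_ l)).
Proof.
move=> dg.
have E : (fun h : R => h^-1 *: (((fun s : R => g (v + s *: e_ l)) \o shift t)
    (h *: (1 : R)) - g (v + t *: e_ l))) =
  (fun h : R => h^-1 *: ((g \o shift (v + t *: e_ l)) (h *: e_ l)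
     - g (v + t *: e_ l))).
  apply/funext => h /=; congr (_ *: (g _ - _)).
  by rewrite [h *: 1]mulr1 scalerDl addrCA addrA.
split; first by rewrite /derivable E.
by rewrite /partial /derive E.
Qed.

Lemma is_derive_shift g (l : 'I_d) v x :
  derivable g (x + v) (e_ l) ->
  is_derive x (e_ l) (fun y => g (y + v)) (partial l g (x + v)).
Proof.
move=> dg.
have E : (fun h : R => h^-1 *: (((fun y => g (y + v)) \o shift x)
    (h *: e_ l) - g (x + v))) =
  (fun h : R => h^-1 *: ((g \o shift (x + v)) (h *: e_ l) - g (x + v))).
  by apply/funext => h /=; rewrite addrA.
split; first by rewrite /derivable E.
by rewrite /partial /derive E.
Qed.

Lemma MVT_partial g (l : 'I_d) v (s : R) :
  (forall x, derivable g x (e_ l)) ->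
  exists2 c : R, `|c| <= `|s| &
    g (v + s *: e_ l) - g v = s * partial l g (v + c *: e_ l).
Proof.
move=> dg; pose phi (t : R) := g (v + t *: e_ l).
have dphi (t : R) : is_derive t 1 phi (partial l g (v + t *: e_ l)).
  exact: is_derive_line.
have cphi : continuous phi.
  by move=> t; apply/differentiable_continuous/derivable1_diffP.
have phi0 : phi 0 = g v by rewrite /phi scale0r addr0.
have [s0|s0] := leP 0 s.
  have [c + E] := MVT_segment s0 (fun t _ => dphi t) (continuous_subspaceT cphi).
  rewrite in_itv/= => /andP[c0 cs]; exists c; first by rewrite !ger0_norm.
  by rewrite -phi0 -/(phi s) E subr0 mulrC.
(* For negative [s] the segment is [[s, 0]]; both orientations fit the bound [|c| <= |s|]. *)
have [c + E] := MVT_segment (ltW s0) (fun t _ => dphi t) (continuous_subspaceT cphi).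
rewrite in_itv/= => /andP[c0 cs]; exists c; first by rewrite !ler0_norm ?(ltW s0)// lerN2.
by rewrite -phi0 -/(phi s) -opprB E sub0r mulrN opprK mulrC.
Qed.

(* Move from [u] to [u + x] one coordinate at a time. *)
Lemma MVT_multi g :
  (forall l x, derivable g x (e_ l)) -> forall u x,
  exists2 c : 'I_d -> 'rV[R]_d, (forall k, `|c k| <= `|x|) &
    g (u + x) - g u = \sum_(k < d) x 0 k * partial k g (u + c k).
Proof.
move=> dg u x.
(* [tr m] keeps the first [m] coordinates of [x]: the path runs from 0 to [x], and its increments
   along [g] telescope. *)
pose tr (m : nat) : 'rV[R]_d := \row_k (if (k < m)%N then x 0 k else 0).
have trS (k : 'I_d) : tr k.+1 = tr k + x 0 k *: e_ k.
  apply/rowP => i; rewrite !mxE eqxx/= ltnS leq_eqVlt.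
  have [->|ik] := eqVneq i k; first by rewrite eqxx ltnn mulr1 add0r.
  by rewrite (negbTE (_ : val i != val k))// mulr0 addr0.
have ex (k : 'I_d) : exists c : R, `|c| <= `|x 0 k| /\
    g (u + tr k.+1) - g (u + tr k) = x 0 k * partial k g (u + (tr k + c *: e_ k)).
  have [c cx E] := MVT_partial (u + tr k) (x 0 k) (dg k).
  by exists c; split => //; rewrite trS addrA E addrA.
have [c /all_and2[cx cE]] := choice ex.
exists (fun k : 'I_d => tr k + c k *: e_ k) => [k|].
  (* The norm is the max norm. Coordinate [k] of the intermediate point is [c k], and every other
     one is 0 or a coordinate of [x]. *)
  apply: norm_le_coord => // i; rewrite !mxE eqxx/=.
  have [->|ik] := eqVneq i k.
    by rewrite ltnn mulr1 add0r (le_trans (cx k))// coord_le_norm.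
  by rewrite mulr0 addr0; case: ifP => _; rewrite ?normr0// coord_le_norm.
rewrite -(eq_bigr _ (fun k _ => cE k)).
rewrite -(big_mkord xpredT (fun k => g (u + tr k.+1) - g (u + tr k))).
rewrite telescope_sumr//; congr (g (u + _) - g _).
  by apply/rowP => i; rewrite mxE ltn_ord.
by apply/rowP => i; rewrite !mxE addr0.
Qed.

Lemma continuous_class_C k g : class_C k g -> continuous g.
Proof. by case: k => [|k]//= -[]. Qed.

Lemma class_C_derivable k g : class_C k.+1 g ->
  forall l x, derivable g x (e_ l).
Proof. by move=> [_ h] l x; have [] := h l. Qed.

Lemma class_C_partial k g l : class_C k.+1 g -> class_C k (partial l g).
Proof. by move=> [_ h]; have [] := h l. Qed.

Lemma schwarz g (j k : 'I_d) u : class_C 2 g ->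
  partial j (partial k g) u = partial k (partial j g) u.
Proof.
move=> Cg.
have dg := class_C_derivable Cg.
have Cpg l := class_C_partial l Cg.
have dpg l := class_C_derivable (Cpg l).
have cppg l m : continuous (partial m (partial l g)).
  exact: continuous_class_C (class_C_partial m (Cpg l)).
(* The second difference is symmetric in the two directions and equals
   [t * t] times either mixed derivative at some point within [2 * |t|]. *)
have DE (a b : 'I_d) (t : R) : exists2 c : 'rV[R]_d, `|c - u| <= 2 * `|t| &
    (g (u + t *: e_ a + t *: e_ b) - g (u + t *: e_ a)
     - (g (u + t *: e_ b) - g u)) = t * t * partial b (partial a g) c.
  (* The second difference is the increment along [e_ a] of this increment along [e_ b]. The mean
     value theorem is applied first in direction [a], then to [partial a g] in direction [b]. *)
  pose f := fun x => g (x + t *: e_ b) - g x.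
  have df x l : is_derive x (e_ l) f (partial l g (x + t *: e_ b) - partial l g x).
    have dfb := is_derive_shift (dg l (x + t *: e_ b)).
    have dgx := derivableP (dg l x).
    exact: is_deriveB.
  have dfa x : derivable f x (e_ a) by case: (df x a).
  have [c ct E] := MVT_partial u t dfa.
  have [c' ct' E'] := MVT_partial (u + c *: e_ a) t (dpg a b).
  exists (u + c *: e_ a + c' *: e_ b).
    rewrite (_ : _ - u = c *: e_ a + c' *: e_ b); last by rewrite -!addrA addrC -!addrA addNr addr0.
    have nd (l : 'I_d) (r : R) : `|r| <= `|t| -> `|r *: e_ l| <= `|t|.
      move=> rt; apply: norm_le_coord => // i; rewrite !mxE eqxx/=.
      by case: eqP => _; rewrite ?mulr1// mulr0 normr0.
    by rewrite (le_trans (ler_normD _ _))// mulr_natl mulr2n lerD// nd.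
  have := E; rewrite /f [partial a f _]/partial (@derive_val _ _ _ _ _ _ _ (df _ a)) E' => e.
  by rewrite -mulrA -e.
apply/eqP; rewrite -subr_eq0 -normr_le0; apply/ler_addgt0Pr => /= e e0.
rewrite add0r.
have e2 : 0 < e / 2 by rewrite divr_gt0.
set A := partial j (partial k g); set B := partial k (partial j g).
have [r r0 Hr] : exists2 r : R, 0 < r & forall y, `|y - u| < r ->
    `|A u - A y| < e / 2 /\ `|B u - B y| < e / 2.
  have /cvgrPdist_lt/(_ _ e2) HA := cppg k j u.
  have /cvgrPdist_lt/(_ _ e2) HB := cppg j k u.
  have : \forall y \near u, `|A u - A y| < e / 2 /\ `|B u - B y| < e / 2.
    exact: filterI HA HB.
  move=> /nbhs_ballP[r /= r0 Hr]; exists r => // y yu.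
  by apply: Hr; rewrite -ball_normE/= distrC.
(* The intermediate points are within [2 * |t| = r / 2] of [u], inside the radius where both mixed
   derivatives vary by less than [e / 2]. *)
pose t := r / 4.
have t0 : 0 < t by rewrite divr_gt0.
have [c cu Ec] := DE j k t.
have [c' cu' Ec'] := DE k j t.
have tr : 2 * `|t| < r.
  by rewrite gtr0_norm// /t; move: r0; clear; lra.
have EE : B c = A c'.
  have tt : t * t != 0 by rewrite mulf_neq0 ?gt_eqF.
  apply: (mulfI tt); apply: etrans (esym Ec) (etrans _ Ec').
  rewrite [u + t *: e_ k + _]addrAC.
  by move: (g _) (g _) (g _) (g _) => x y z w; clear; lra.
have [_ h1] := Hr c (le_lt_trans cu tr).
have [h2 _] := Hr c' (le_lt_trans cu' tr).
rewrite EE in h1; move: (A u) (B u) (A c') h1 h2 => a b z; clear => h1 h2.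
rewrite (_ : a - b = (a - z) - (b - z)); last by rewrite opprB addrA subrK.
rewrite (le_trans (ler_normB _ _))//; move: h1 h2; lra.
Qed.

End calculus.

(** * Second-order Taylor formula *)

Section taylor.
Context {R : realType} {d : nat}.
Implicit Types (g h : 'rV[R]_d -> R) (u v x : 'rV[R]_d).

Local Notation e_ l := (delta_mx 0 l : 'rV[R]_d).

Lemma is_derive_sumf n (h : 'I_n -> 'rV[R]_d -> R) (dh : 'I_n -> R) x v :
  (forall i, is_derive x v (h i) (dh i)) ->
  is_derive x v (fun y => \sum_(i < n) h i y) (\sum_(i < n) dh i).
Proof. by move=> H; have := is_derive_sum H; rewrite fct_sumE. Qed.

Lemma norm_sum_le n (F : 'I_n -> R) (c : R) :
  (forall i, `|F i| <= c) -> `|\sum_(i < n) F i| <= n%:R * c.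
Proof.
move=> Fc; apply: le_trans (ler_norm_sum _ _ _) _.
by rewrite -[n in leRHS]card_ord mulr_natl -sumr_const; exact: ler_sum.
Qed.

Lemma is_derive_coord (k l : 'I_d) x :
  is_derive x (e_ l) (fun y => y 0 k) (k == l)%:R.
Proof.
have E : (fun h : R => h^-1 *: (((fun y : 'rV[R]_d => y 0 k) \o shift x) (h *: e_ l) - x 0 k))
    @ 0^' --> ((k == l)%:R : R).
  apply: cvg_near_cst; near=> h; rewrite /= !mxE eqxx/= addrK.
  rewrite [_ *: _]mulrA mulVf ?mul1r//.
  by near: h; exact: nbhs_dnbhs_neq.
split; first by apply/cvg_ex; exists (k == l)%:R.
exact: cvg_lim E.
Unshelve. all: by end_near. Qed.

(** Differentiating the double sum produces a row sum and a column sum of [H]; symmetry makes them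
    equal, and the factor 1/2 cancels. With [H = 0] the lemma also differentiates linear forms. *)
Lemma is_derive_quadratic (b : 'I_d -> R) (H : 'I_d -> 'I_d -> R) (l : 'I_d) x :
  (forall j k, H j k = H k j) ->
  is_derive x (e_ l) (fun y => \sum_(k < d) y 0 k * b k
      + 2^-1 * \sum_(j < d) \sum_(k < d) y 0 j * y 0 k * H j k)
    (b l + \sum_(j < d) x 0 j * H j l).
Proof.
move=> symH.
have D1 : is_derive x (e_ l) (fun y => \sum_(k < d) y 0 k * b k) (b l).
  have -> : b l = \sum_(k < d) (k == l)%:R * b k.
    by rewrite (bigD1 l)//= eqxx mul1r big1 ?addr0// => i /negbTE ->; rewrite mul0r.
  apply: is_derive_sumf => k.
  have := @is_deriveM _ _ (fun y : 'rV[R]_d => y 0 k) (cst (b k)) x (e_ l) _ _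
    (is_derive_coord k l x) (is_derive_cst _ _ _).
  by rewrite scaler0 add0r [_ *: _]mulrC.
have D2 : is_derive x (e_ l)
    (fun y => \sum_(j < d) \sum_(k < d) y 0 j * y 0 k * H j k)
    (\sum_(j < d) \sum_(k < d)
      (x 0 j * (k == l)%:R * H j k + x 0 k * (j == l)%:R * H j k)).
  apply: is_derive_sumf => j; apply: is_derive_sumf => k.
  have := @is_deriveM _ _ _ (cst (H j k)) x (e_ l) _ _
    (@is_deriveM _ _ (fun y : 'rV[R]_d => y 0 j) (fun y : 'rV[R]_d => y 0 k) x (e_ l) _ _
      (is_derive_coord j l x) (is_derive_coord k l x)) (is_derive_cst _ _ _).
  rewrite scaler0 add0r [X in is_derive _ _ _ X -> _](_ : _ =
    x 0 j * (k == l)%:R * H j k + x 0 k * (j == l)%:R * H j k)//.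
  by rewrite [_ *: _]mulrC -mulrDl.
have D3 := @is_deriveM _ _ (cst (2^-1)) _ x (e_ l) _ _ (is_derive_cst _ _ _) D2.
have := is_deriveD D1 D3.
rewrite [X in is_derive _ _ _ X -> _](_ : _ = b l + \sum_(j < d) x 0 j * H j l)//.
congr (_ + _); rewrite scaler0 addr0.
have -> : \sum_(j < d) \sum_(k < d)
      (x 0 j * (k == l)%:R * H j k + x 0 k * (j == l)%:R * H j k) =
    \sum_(j < d) x 0 j * H j l + \sum_(k < d) x 0 k * H k l.
  under eq_bigr do rewrite big_split/=.
  rewrite big_split/=; congr (_ + _).
    apply: eq_bigr => j _; rewrite (bigD1 l)//= eqxx mulr1 big1 ?addr0//.
    by move=> i /negbTE ->; rewrite mulr0 mul0r.
  rewrite exchange_big/=.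
  apply: eq_bigr => k _; rewrite (bigD1 l)//= eqxx mulr1 big1 ?addr0 1?symH//.
  by move=> i /negbTE ->; rewrite mulr0 mul0r.
by rewrite /cst [_ *: _]mulrC; lra.
Qed.

(** Subtracting the quadratic polynomial leaves a function that vanishes at 0 together with its
    first partials, and whose second partials are increments of those of [g], hence small near 0 by
    continuity. *)
Lemma taylor2_peano g u : class_C 2 g -> forall e : R, 0 < e ->
  exists2 r : R, 0 < r & forall x, `|x| < r ->
    `|g (u + x) - (g u + (\sum_(k < d) x 0 k * partial k g u
       + 2^-1 * \sum_(j < d) \sum_(k < d)
           x 0 j * x 0 k * partial j (partial k g) u))| <= e * `|x| ^+ 2.
Proof.
move=> Cg e e0.
have dg := class_C_derivable Cg.
have Cpg l := class_C_partial l Cg.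
have dpg l := class_C_derivable (Cpg l).
have cppg l m : continuous (partial m (partial l g)).
  exact: continuous_class_C (class_C_partial m (Cpg l)).
(* Two mean value expansions each sum over [d] coordinates, so [d * d * e' <= e] is required; the 1
   keeps the denominator positive when [d = 0]. *)
pose e' := e / (d%:R * d%:R + 1).
have dd : 0 < d%:R * d%:R + 1 :> R by rewrite ltr_wpDl// mulr_ge0.
have e'0 : 0 < e' by rewrite divr_gt0.
have near1 m l : \forall y \near u,
    `|partial m (partial l g) u - partial m (partial l g) y| < e'.
  by have /cvgrPdist_lt/(_ _ e'0) := cppg l m u.
have : \forall y \near u, forall m l,
    `|partial m (partial l g) u - partial m (partial l g) y| < e'.
  exact: (filter_forall _ (fun m => filter_forall _ (near1 m))).
move=> /nbhs_ballP[r /= r0 Hr]; exists r => // x xr.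
pose b k := partial k g u.
pose H j k := partial j (partial k g) u.
have symH j k : H j k = H k j by exact: schwarz.
pose q := fun y : 'rV[R]_d => \sum_(k < d) y 0 k * b k
      + 2^-1 * \sum_(j < d) \sum_(k < d) y 0 j * y 0 k * H j k.
pose h := fun y : 'rV[R]_d => g (y + u) - q y.
have dh l y : is_derive y (e_ l) h
    (partial l g (y + u) - (b l + \sum_(j < d) y 0 j * H j l)).
  have D1 := is_derive_shift (dg l (y + u)).
  have D2 := is_derive_quadratic b l y symH.
  exact: (is_deriveB D1 D2).
have dh1 l y : derivable h y (e_ l) by case: (dh l y).
(* A zero quadratic part is inserted so that [partial l h] has the shape to which
   [is_derive_quadratic] applies a second time. *)
have zz (y : 'rV[R]_d) : \sum_(j < d) \sum_(k < d) y 0 j * y 0 k * 0 = 0.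
  by rewrite big1// => j _; rewrite big1// => k _; rewrite mulr0.
have ph l : partial l h = fun y => partial l g (y + u) -
    (\sum_(j < d) y 0 j * H j l
     + 2^-1 * \sum_(j < d) \sum_(k < d) y 0 j * y 0 k * 0) - b l.
  apply/funext => y; rewrite [LHS](@derive_val _ _ _ _ _ _ _ (dh l y)).
  by rewrite zz mulr0 addr0 opprD addrA addrAC.
have dph l m y : is_derive y (e_ m) (partial l h)
    (partial m (partial l g) (y + u) - H m l).
  rewrite ph.
  have D1 := is_derive_shift (dpg l m (y + u)).
  have D2 := @is_derive_quadratic (fun j => H j l) (fun _ _ => 0) m y
    (fun _ _ => erefl).
  have D3 := is_derive_cst (b l) y (e_ m).
  have := is_deriveB (is_deriveB D1 D2) D3.
  rewrite [X in is_derive _ _ _ X -> _](_ : _ =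
    partial m (partial l g) (y + u) - H m l)//.
  have -> : \sum_(j < d) y 0 j * 0 = 0 by apply: big1 => j _; rewrite mulr0.
  move: (partial m (partial l g) (y + u)) (H m l) => p1 p2.
  by rewrite subr0 addr0.
have dph1 l m y : derivable (partial l h) y (e_ m) by case: (dph l m y).
have ph0 l : partial l h 0 = 0.
  rewrite ph add0r zz mulr0 addr0 big1 ?subr0 ?subrr// => j _.
  by rewrite mxE mul0r.
have q0 : q 0 = 0.
  rewrite /q big1 => [|k _]; last by rewrite mxE mul0r.
  rewrite big1 ?mulr0 ?addr0// => j _.
  by apply: big1 => k _; rewrite mxE !mul0r.
rewrite -/(q x).
rewrite (_ : _ - _ = h (0 + x) - h 0); last first.
  by rewrite /h q0 !add0r subr0 [x + u]addrC; ring.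
(* [h] vanishes at 0 to second order: apply the mean value theorem to [h] and
   then to its partial derivatives. *)
have [c cx ->] := MVT_multi dh1 0 x.
have bnd k : `|partial k h (0 + c k)| <= d%:R * (`|x| * e').
  rewrite -[partial k h _]subr0 -[X in _ - X](ph0 k).
  have [c' cx' ->] := MVT_multi (dph1 k) 0 (c k).
  apply: norm_sum_le => j; rewrite normrM ler_pM//.
    by rewrite (le_trans (coord_le_norm _ _)).
  rewrite [partial j _ _](@derive_val _ _ _ _ _ _ _ (dph k j _)).
  rewrite distrC ltW//; apply: Hr; rewrite -ball_normE/= add0r.
  by rewrite distrC addrK (le_lt_trans (cx' j))// (le_lt_trans (cx k)).
apply: le_trans (norm_sum_le (c := `|x| * (d%:R * (`|x| * e'))) _) _.
  by move=> k; rewrite normrM ler_pM// coord_le_norm.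
rewrite (_ : _ * _ = (d%:R * d%:R * e') * `|x| ^+ 2); last by ring.
rewrite ler_wpM2r ?exprn_ge0// /e' mulrCA ger_pMr//.
by rewrite ler_pdivrMr// mul1r lerDl.
Qed.

End taylor.

(** * The Laplacian of the squared Frobenius norm *)

Section class_C_theory.
Context {R : realType} {d : nat}.
Implicit Types (g h : 'rV[R]_d -> R) (u v x : 'rV[R]_d).

Local Notation e_ l := (delta_mx 0 l : 'rV[R]_d).

Lemma class_CW k g : class_C k.+1 g -> class_C k g.
Proof.
elim: k g => [|k ih] g; first by case.
move=> [cg Hg]; split => // l; have [dg Cg] := Hg l; split => //.
exact: ih.
Qed.

Lemma partialD g h l : (forall x, derivable g x (e_ l)) ->
  (forall x, derivable h x (e_ l)) ->
  partial l (fun x => g x + h x) = fun x => partial l g x + partial l h x.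
Proof. by move=> dg dh; apply/funext => x; exact: deriveD. Qed.

Lemma partialB g h l : (forall x, derivable g x (e_ l)) ->
  (forall x, derivable h x (e_ l)) ->
  partial l (fun x => g x - h x) = fun x => partial l g x - partial l h x.
Proof. by move=> dg dh; apply/funext => x; exact: deriveB. Qed.

Lemma partialM g h l : (forall x, derivable g x (e_ l)) ->
  (forall x, derivable h x (e_ l)) ->
  partial l (fun x => g x * h x) =
  fun x => g x * partial l h x + h x * partial l g x.
Proof. by move=> dg dh; apply/funext => x; exact: deriveM. Qed.

Lemma partial_sum n (g : 'I_n -> 'rV[R]_d -> R) l :
  (forall i x, derivable (g i) x (e_ l)) ->
  partial l (fun x => \sum_(i < n) g i x) =
  fun x => \sum_(i < n) partial l (g i) x.
Proof.
move=> dg; apply/funext => x; rewrite -fct_sumE.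
by apply: derive_sum => i; exact: dg.
Qed.

Lemma class_CD k g h : class_C k g -> class_C k h ->
  class_C k (fun x => g x + h x).
Proof.
elim: k g h => [|k ih] g h.
  by move=> /= cg ch x; exact: (cvgD (cg x) (ch x)).
move=> [cg Hg] [ch Hh]; split.
  by move=> x; exact: (cvgD (cg x) (ch x)).
move=> l; have [dg Cg] := Hg l; have [dh Ch] := Hh l; split.
  by move=> u; exact: derivableD (dg u) (dh u).
by rewrite (partialD dg dh); exact: (ih _ _ Cg Ch).
Qed.

Lemma class_CB k g h : class_C k g -> class_C k h ->
  class_C k (fun x => g x - h x).
Proof.
elim: k g h => [|k ih] g h.
  by move=> /= cg ch x; exact: (cvgB (cg x) (ch x)).
move=> [cg Hg] [ch Hh]; split.
  by move=> x; exact: (cvgB (cg x) (ch x)).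
move=> l; have [dg Cg] := Hg l; have [dh Ch] := Hh l; split.
  by move=> u; exact: derivableB (dg u) (dh u).
by rewrite (partialB dg dh); exact: (ih _ _ Cg Ch).
Qed.

Lemma class_CM k g h : class_C k g -> class_C k h ->
  class_C k (fun x => g x * h x).
Proof.
elim: k g h => [|k ih] g h.
  by move=> /= cg ch x; exact: (cvgM (cg x) (ch x)).
move=> Cg Ch; split.
  by move=> x; exact: (cvgM (Cg.1 x) (Ch.1 x)).
move=> l; have [dg Cpg] := Cg.2 l; have [dh Cph] := Ch.2 l; split.
  by move=> u; exact: derivableM (dg u) (dh u).
(* Each term pairs a derivative with an undifferentiated factor, whose class is lowered by one to
   fit the induction hypothesis. *)
rewrite (partialM dg dh); apply: class_CD.
  exact: ih (class_CW Cg) Cph.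
exact: ih (class_CW Ch) Cpg.
Qed.

Lemma class_C0 k : class_C k (fun _ : 'rV[R]_d => 0).
Proof.
elim: k => [|k ih] /=; first exact: cst_continuous.
split; first exact: cst_continuous.
move=> l; split; first by move=> u; exact: derivable_cst.
rewrite (_ : partial l _ = fun=> 0)//.
by apply/funext => x; exact: derive_cst.
Qed.

Lemma class_C_sum k n (g : 'I_n -> 'rV[R]_d -> R) :
  (forall i, class_C k (g i)) -> class_C k (fun x => \sum_(i < n) g i x).
Proof.
elim: n g => [|n ih] g Cg.
  by under eq_fun do rewrite big_ord0; exact: class_C0.
under eq_fun do rewrite big_ord_recl.
by apply: class_CD => //; exact: ih.
Qed.

Lemma class_C_sqr k g : class_C k g -> class_C k (fun x => g x ^+ 2).
Proof. by move=> Cg; under eq_fun do rewrite expr2; exact: class_CM. Qed.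

Lemma partial_sqr g l : (forall x, derivable g x (e_ l)) ->
  partial l (fun x => g x ^+ 2) = fun x => 2 * (g x * partial l g x).
Proof.
move=> dg; under eq_fun do rewrite expr2.
rewrite (partialM dg dg); apply/funext => x.
by rewrite mulr_natl mulr2n.
Qed.

Lemma partial2_sqr g l u : class_C 2 g ->
  partial l (partial l (fun x => g x ^+ 2)) u =
  2 * (partial l g u ^+ 2 + g u * partial l (partial l g) u).
Proof.
move=> Cg; have dg := class_C_derivable Cg.
have dpg := class_C_derivable (class_C_partial l Cg).
rewrite (partial_sqr (dg l)).
rewrite (_ : (fun x => _) =
    fun x => g x * partial l g x + g x * partial l g x); last first.
  by apply/funext => x; rewrite mulr_natl mulr2n.
have dm x : derivable (fun x => g x * partial l g x) x (e_ l).
  exact: derivableM (dg l x) (dpg l x).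
rewrite (partialD dm dm) (partialM (dg l) (dpg l)).
by move: (partial l g u) (partial l (partial l g) u) => a b; ring.
Qed.

End class_C_theory.

(** * Derivatives of the Jacobian mismatch *)

Section frobenius.
Context {R : realType} {d : nat}.
Variables f fhat : 'rV[R]_d -> 'rV[R]_d.
Hypotheses (Cf : field_class_C 3 f) (Cfhat : field_class_C 3 fhat).

Let a (i l : 'I_d) (x : 'rV[R]_d) := delta_jac f fhat x i l.

Let aE i l : a i l = fun x => partial l (comp_field fhat i) x
  - partial l (comp_field f i) x.
Proof. by apply/funext => x; rewrite /a !mxE. Qed.

Let Ca i l : class_C 2 (a i l).
Proof.
rewrite aE; apply: class_CB; first exact: class_C_partial (Cfhat i).
exact: class_C_partial (Cf i).
Qed.

Let frobE : (fun x => frob2 (delta_jac f fhat x)) =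
  fun x => \sum_(i < d) \sum_(l < d) a i l x ^+ 2.
Proof. by []. Qed.

Lemma class_C_frob2 : class_C 2 (fun x => frob2 (delta_jac f fhat x)).
Proof.
rewrite frobE; apply: class_C_sum => i; apply: class_C_sum => l.
exact: class_C_sqr.
Qed.

Let partial_a i j l : partial j (a i l) = fun x => delta_hess f fhat x i j l.
Proof.
rewrite aE partialB//; move=> x.
  exact: class_C_derivable (class_C_partial l (Cfhat i)) _ _.
exact: class_C_derivable (class_C_partial l (Cf i)) _ _.
Qed.

Let partial2_a i j l u : partial j (partial j (a i l)) u =
  delta_third f fhat u i l j j.
Proof.
(* Two exchanges bring [partial l] outermost, as in [third]. The first takes place under a
   derivative, hence is an equality of functions; the second is Schwarz for
   [partial j (comp_field h i)], which is of class 2. *)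
have third_swap (h : 'rV[R]_d -> 'rV[R]_d) : field_class_C 3 h ->
    partial j (partial j (partial l (comp_field h i))) u =
    partial l (partial j (partial j (comp_field h i))) u.
  move=> Ch.
  rewrite (_ : partial j (partial l _) = partial l (partial j (comp_field h i))).
    exact: schwarz (class_C_partial j (Ch i)).
  by apply/funext => x; apply: schwarz; exact: class_CW.
have Cp (h : 'rV[R]_d -> 'rV[R]_d) : field_class_C 3 h ->
    class_C 1 (partial j (partial l (comp_field h i))).
  by move=> Ch; apply: class_C_partial; apply: class_C_partial.
rewrite partial_a /delta_hess /hess partialB.
- exact: (congr2 (fun a b => a - b) (third_swap _ Cfhat) (third_swap _ Cf)).
- by move=> x; exact: class_C_derivable (Cp _ Cfhat) _ _.
- by move=> x; exact: class_C_derivable (Cp _ Cf) _ _.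
Qed.

(** Each squared entry [a] contributes twice the square of its [j]-derivative plus twice [a] times
    its second [j]-derivative. Summing the latter over [j] forms the partial trace, and 1/2 removes
    the factor 2. *)
Lemma laplacian_frob2 u :
  2^-1 * \sum_(j < d) partial j (partial j
    (fun x => frob2 (delta_jac f fhat x))) u =
  frob2_tensor3 (delta_hess f fhat u) + \sum_(i < d) \sum_(l < d)
    delta_jac f fhat u i l * tr_last2 (delta_third f fhat u) i l.
Proof.
have E j : partial j (partial j (fun x => frob2 (delta_jac f fhat x))) u =
    \sum_(i < d) \sum_(l < d) 2 * (delta_hess f fhat u i j l ^+ 2
      + delta_jac f fhat u i l * delta_third f fhat u i l j j).
  have C1 i l := class_C_sqr (Ca i l).
  have C2 i := class_C_sum (C1 i).
  rewrite frobE partial_sum; last first.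
    by move=> i x; exact: class_C_derivable (C2 i) _ _.
  rewrite partial_sum; last first.
    by move=> i x; exact: class_C_derivable (class_C_partial j (C2 i)) _ _.
  apply: eq_bigr => i _.
  rewrite partial_sum; last first.
    by move=> l x; exact: class_C_derivable (C1 i l) _ _.
  rewrite partial_sum; last first.
    by move=> l x; exact: class_C_derivable (class_C_partial j (C1 i l)) _ _.
  apply: eq_bigr => l _.
  by rewrite partial2_sqr// partial2_a partial_a.
under eq_bigr do rewrite E.
rewrite exchange_big/= mulr_sumr -big_split/=; apply: eq_bigr => i _.
rewrite exchange_big/= mulr_sumr.
rewrite [X in _ = X + _]exchange_big/= -big_split/=; apply: eq_bigr => l _.
rewrite /tr_last2 [in RHS]mulr_sumr -big_split/=.
rewrite mulr_sumr; apply: eq_bigr => j _.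
by rewrite mulrA mulVf ?mul1r ?pnatr_eq0.
Qed.

End frobenius.

(** * One-dimensional normal distributions *)

Section gaussian_moment.
Context {R : realType}.
Local Notation mu := (@lebesgue_measure R).

(** Change of variables is available for the Radon-Nikodym derivative, which agrees almost
    everywhere with the density because both have the same integral over every measurable set. *)
Lemma integral_normal_prob (m s : R) (f : R -> \bar R) :
  measurable_fun [set: R] f -> (forall x, (0 <= f x)%E) ->
  (\int[normal_prob m s]_x f x = \int[mu]_x (f x * (normal_pdf m s x)%:E))%E.
Proof.
move=> mf f0.
have dom := normal_prob_dominates m s.
rewrite -(Radon_Nikodym_SigmaFinite.change_of_variables dom f0 measurableT mf).
have int_f := Radon_Nikodym_SigmaFinite.f_integrable dom.
have mpdf : measurable_fun setT (fun x => (normal_pdf m s x)%:E).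
  by apply/measurable_EFinP; exact: measurable_normal_pdf.
apply: ae_eq_integral => //.
- by apply: emeasurable_funM => //; exact: (measurable_int mu int_f).
- exact: emeasurable_funM.
- apply: ae_eqe_mul2l; apply: integral_ae_eq => // E _ mE.
  by rewrite -Radon_Nikodym_SigmaFinite.f_integral.
Qed.

Variable s : R.
Hypothesis s_gt0 : 0 < s.

Let p : R -> R := normal_pdf 0 s.

Let pE : p = fun x => normal_peak s * expR (- (x ^+ 2) / (s ^+ 2 *+ 2)).
Proof.
by rewrite /p normal_pdfE ?gt_eqF//; apply/funext => x; rewrite /normal_fun subr0.
Qed.

Let is_derive_p (x : R) : is_derive x (1 : R) p (- (x / s ^+ 2) * p x).
Proof.
rewrite pE.
have D1 : is_derive x (1 : R) (fun x : R => - (x ^+ 2) / (s ^+ 2 *+ 2)) (- (x / s ^+ 2)).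
  apply: is_derive_eq.
  rewrite /= /GRing.scale/= ?expr1 ?mulr1 ?mulr0 ?add0r ?addr0.
  have := lt0r_neq0 s_gt0; move=> s0; field.
  by rewrite s0.
have D2 := @is_derive1_comp R expR (fun x : R => - (x ^+ 2) / (s ^+ 2 *+ 2)) x _ _
  (is_derive_expR _) D1.
have := is_deriveM (is_derive_cst (normal_peak s) x 1) D2.
set D := (X in is_derive _ _ _ X); suff -> : D = - (x / s ^+ 2)
    * (normal_peak s * expR (- (x ^+ 2) / (s ^+ 2 *+ 2))) by [].
by rewrite /D /GRing.scale/= /cst; ring.
Qed.

Let cp : continuous p.
Proof. by apply: continuous_normal_pdf; rewrite gt_eqF. Qed.

Let q x := x ^+ 2 * p x.

Let cq : continuous q.
Proof. by move=> x; apply: cvgM; [exact: exprn_continuous|exact: cp]. Qed.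

Let p_even x : p (- x) = p x.
Proof. by rewrite pE sqrrN. Qed.

Let p_ge0 x : 0 <= p x.
Proof. exact: normal_pdf_ge0. Qed.

Let half_line (f : R -> R) : (forall x, 0 <= f x) -> continuous f ->
  (forall x, f (- x) = f x) ->
  (\int[mu]_x (f x)%:E = 2%:E * \int[mu]_(x in `[0%R, +oo[) (f x)%:E)%E.
Proof.
move=> f0 cf fN; rewrite ge0_symfun_integralT//; last by move=> x /=; rewrite fN.
congr (_ * integral _ _ _)%E; apply/seteqP; split => x /=.
  by rewrite in_itv/= andbT.
by rewrite in_itv/= andbT.
Qed.

(** Integration by parts, based on [p' = - (x / s ^+ 2) * p]; the boundary term at 0 vanishes and
    the one at [n] is kept. *)
Let partial_moment (n : R) : 0 < n ->
  (\int[mu]_(x in `[0%R, n]) (q x)%:E =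
   (s ^+ 2)%:E * \int[mu]_(x in `[0%R, n]) (p x)%:E - (s ^+ 2 * (n * p n))%:E)%E.
Proof.
move=> n0.
(* [F] is an antiderivative of [q - s ^+ 2 * p]. *)
pose F x := - s ^+ 2 * (x * p x).
have dF (x : R) : is_derive x (1 : R) F (q x - s ^+ 2 * p x).
  have Dxp := is_deriveM (is_derive_id x (1 : R)) (is_derive_p x).
  have := is_deriveM (is_derive_cst (- s ^+ 2) x (1 : R)) Dxp.
  set D := (X in is_derive _ _ _ X); suff -> : D = q x - s ^+ 2 * p x by [].
  rewrite /D /GRing.scale/= /cst /q.
  have := lt0r_neq0 s_gt0; move: (p x) => px s0; field.
  by rewrite s0.
have cF : continuous F.
  by move=> x; apply/differentiable_continuous/derivable1_diffP.
have csp : continuous (fun x => s ^+ 2 * p x).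
  by move=> x; apply: cvgM; [exact: cvg_cst|exact: cp].
have FTC := @continuous_FTC2 R (fun x => q x - s ^+ 2 * p x) F 0 n n0.
have int_of (f : R -> R) : continuous f -> mu.-integrable `[0%R, n] (EFin \o f).
  move=> cf; apply: continuous_compact_integrable; first exact: segment_compact.
  exact: continuous_subspaceT.
have E : (\int[mu]_(x in `[0%R, n]) (q x - s ^+ 2 * p x)%:E = (F n)%:E - (F 0)%:E)%E.
  apply: FTC.
  - by apply: continuous_subspaceT => x; apply: cvgB; [exact: cq|exact: csp].
  - by split; [|exact/cvg_at_right_filter/cF|exact/cvg_at_left_filter/cF].
  - by move=> x _; rewrite derive1E; exact: derive_val.
move: E; under eq_integral do rewrite EFinB.
rewrite integralB//; [|exact: int_of|exact: int_of].
have -> : (\int[mu]_(x in `[0%R, n]) (s ^+ 2 * p x)%:E =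
    (s ^+ 2)%:E * \int[mu]_(x in `[0%R, n]) (p x)%:E)%E.
  under eq_integral do rewrite EFinM.
  by rewrite integralZl//; exact: int_of.
rewrite /F mul0r mulr0 sube0 mulNr => E.
have fp : (\int[mu]_(x in `[0%R, n]) (p x)%:E)%E \is a fin_num.
  by apply: integrable_fin_num => //; exact: int_of.
have fq : (\int[mu]_(x in `[0%R, n]) (q x)%:E)%E \is a fin_num.
  by apply: integrable_fin_num => //; exact: int_of.
move: E; rewrite -(fineK fp) -(fineK fq) -!EFinM -!EFinB => -[] E.
by congr EFin; rewrite addrC -E; ring.
Qed.

(** By evenness the integral is twice that over the half line, itself the limit over [[0, n]]. There
    integration by parts leaves [s ^+ 2] times the half mass 1/2, and a boundary term tending to
    0. *)
Lemma second_moment_normal_prob :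
  (\int[normal_prob 0 s]_x (x ^+ 2)%:E = (s ^+ 2)%:E)%E.
Proof.
rewrite integral_normal_prob; last 2 first.
- by apply/measurable_EFinP; exact: exprn_measurable.
- by move=> x; rewrite lee_fin sqr_ge0.
under eq_integral do rewrite -EFinM.
have q_ge0 x : 0 <= q x by rewrite mulr_ge0 ?sqr_ge0.
rewrite (half_line q_ge0 cq); last by move=> x; rewrite /q p_even sqrrN.
have mq : measurable_fun setT q by exact: continuous_measurable_fun.
have mp : measurable_fun setT p by exact: continuous_measurable_fun.
have Hq := @ge0_cvgn_integral R mu q q_ge0 mq.
have Hp := @ge0_cvgn_integral R mu p p_ge0 mp.
have P1 : (\int[mu]_(x in `[0%R, +oo[) (p x)%:E = (2^-1)%:E)%E.
  have := integral_normal_pdf 0 s; rewrite (half_line p_ge0 cp)//.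
  move=> /(congr1 (fun z => (2^-1)%:E * z)%E).
  by rewrite muleA -EFinM mulVf// mul1e mule1.
have tail : (s ^+ 2 * (n%:R * p n%:R)) @[n --> \oo] --> (0 : R).
  (* With [t = n ^+ 2 / (2 * s ^+ 2)], the inequality [t <= expR t] bounds [n ^+ 2 * expR (- t)] by
     [2 * s ^+ 2], so the boundary term is at most [K / n]; the index is shifted to keep [n]
     positive. *)
  pose K := s ^+ 2 * (normal_peak s * (s ^+ 2 *+ 2)).
  have bound n : s ^+ 2 * (n.+1%:R * p n.+1%:R) <= K / n.+1%:R.
    rewrite /K -mulrA ler_wpM2l ?sqr_ge0// pE /=.
    rewrite ler_pdivlMr// mulrCA -mulrA ler_wpM2l ?normal_peak_ge0//.
    set t := n.+1%:R ^+ 2 / (s ^+ 2 *+ 2).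
    have s20 : 0 < s ^+ 2 *+ 2 by rewrite mulrn_wgt0// exprn_gt0.
    have t0 : 0 <= t by rewrite divr_ge0 ?sqr_ge0// ltW.
    rewrite mulNr -/t expRN mulrAC -expr2 ler_pdivrMr ?expR_gt0//.
    rewrite -ler_pdivrMl// mulrC -/t.
    by rewrite (le_trans _ (expR_ge1Dx t))// lerDr.
  rewrite -cvg_shiftS/=.
  apply: (@squeeze_cvgr _ _ _ _ (cst 0) (fun n => K / n.+1%:R)).
  - by apply: nearW => n; rewrite bound andbT mulr_ge0 ?sqr_ge0 ?mulr_ge0 ?ler0n ?p_ge0.
  - exact: cvg_cst.
  - rewrite -(mulr0 K); apply: cvgM; [exact: cvg_cst|exact: cvg_harmonic].
have Hlim : (\int[mu]_(x in `[0%R, n%:R]) (q x)%:E)%E @[n --> \oo] -->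
    ((s ^+ 2)%:E * (2^-1)%:E - 0%:E)%E.
  have C1 : ((s ^+ 2)%:E * \int[mu]_(x in `[0%R, n%:R]) (p x)%:E)%E @[n --> \oo]
      --> ((s ^+ 2)%:E * (2^-1)%:E)%E.
    by apply: cvgeZl => //; rewrite -P1; exact: Hp.
  have C2 : (s ^+ 2 * (n%:R * p n%:R))%:E @[n --> \oo] --> (0 : R)%:E.
    by apply: cvg_EFin; [exact: nearW|exact: tail].
  apply: cvg_trans (cvgeB _ C1 C2) => //.
  apply: near_eq_cvg; near=> n; rewrite /= -partial_moment// ltr0n.
  by near: n; exact: nbhs_infty_gt.
have -> := cvg_unique _ Hq Hlim.
by rewrite sube0 -!EFinM mulrCA divff// mulr1.
Unshelve. all: by end_near. Qed.

End gaussian_moment.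

(** * Reflection of a centred normal law and comparison of two scales *)

Section gaussian_comparison.
Context {R : realType}.
Local Notation mu := (@lebesgue_measure R).

Lemma normal_probN (s : R) (A : set R) : s != 0 -> measurable A ->
  normal_prob 0 s ((-%R : R -> R) @^-1` A) = normal_prob 0 s A.
Proof.
move=> s0 mA; rewrite /normal_prob.
have pdfN x : normal_pdf 0 s x = normal_pdf 0 s (- x).
  by rewrite normal_pdfE// /normal_fun !subr0 sqrrN.
under eq_integral do rewrite pdfN.
have mpdf : measurable_fun A (fun x => (normal_pdf 0 s x)%:E).
  by apply: measurable_funTS; apply/measurable_EFinP; exact: measurable_normal_pdf.
have E := @ge0_integral_pushforward _ _ (measurableTypeR R) (measurableTypeR R) R
  -%R (@oppr_measurable R _ ) mu A _ mA mpdf.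
rewrite -[LHS]E; last by move=> x _; rewrite lee_fin normal_pdf_ge0.
by apply: eq_measure_integral => //= B mB _; exact: lebesgue_measureN.
Qed.

(** The ratio of the two densities is [t / s * expR (- (x ^+ 2 / 2 * (s ^- 2 - t ^- 2)))]. Since
    [s <= t] it decreases in [|x|], so on [r <= |x|] it is at most its value at [r]. *)
Lemma normal_prob_le (s t r : R) (A : set R) : 0 < s <= t -> 0 <= r ->
  measurable A -> (forall x, A x -> r <= `|x|) ->
  (normal_prob 0 s A <=
   (t / s * expR (- (r ^+ 2 / 2 * (s ^- 2 - t ^- 2))))%:E * normal_prob 0 t A)%E.
Proof.
move=> /andP[s0 st] r0 mA rA; have t0 : 0 < t := lt_le_trans s0 st.
have sq (x : R) : r <= `|x| -> r ^+ 2 <= x ^+ 2.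
  by move=> rx; rewrite -[x ^+ 2]real_normK ?num_real// ler_pXn2r ?nnegrE.
have ts : 0 <= s ^- 2 - t ^- 2.
  by rewrite subr_ge0 lef_pV2 ?posrE ?exprn_gt0// ler_pXn2r ?nnegrE ?(ltW s0) ?(ltW t0).
rewrite /normal_prob -ge0_integralZl//=; last 3 first.
- by apply: measurable_funTS; apply/measurable_EFinP; exact: measurable_normal_pdf.
- by move=> x _; rewrite lee_fin normal_pdf_ge0.
- by rewrite lee_fin mulr_ge0 ?expR_ge0// divr_ge0 ?ltW.
apply: ge0_le_integral => //.
- by move=> x _; rewrite lee_fin normal_pdf_ge0.
- by apply: measurable_funTS; apply/measurable_EFinP; exact: measurable_normal_pdf.
- apply: measurable_funTS; apply/measurable_EFinP; apply: measurable_funM => //.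
  exact: measurable_normal_pdf.
move=> x Ax; rewrite lee_fin !normal_pdfE ?gt_eqF// /normal_fun !subr0.
have -> : normal_peak s = t / s * normal_peak t.
  rewrite /normal_peak -!mulrnAr (sqrtrM _ (sqr_ge0 s)) (sqrtrM _ (sqr_ge0 t)).
  rewrite !sqrtr_sqr !gtr0_norm// !invfM mulrA; congr (_ * _).
  by rewrite mulrAC mulfV ?mul1r// gt_eqF.
rewrite -[leLHS]mulrA -[leRHS]mulrA; apply: ler_wpM2l.
  by rewrite divr_ge0 ?ltW.
rewrite [leRHS]mulrCA; apply: ler_wpM2l; first exact: normal_peak_ge0.
rewrite -expRD ler_expR.
have xr : r ^+ 2 <= x ^+ 2 by exact: sq (rA _ Ax).
have -> : - x ^+ 2 / (s ^+ 2 *+ 2) =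
    - (x ^+ 2 / 2 * (s ^- 2 - t ^- 2)) + - x ^+ 2 / (t ^+ 2 *+ 2).
  have := lt0r_neq0 s0; have := lt0r_neq0 t0; move=> t1 s1; field.
  by rewrite t1 s1.
by rewrite lerD2r lerN2 ler_wpM2r// ler_wpM2r.
Qed.

End gaussian_comparison.

(** * Comparing integrals through boxes *)

Section rational_cells.
Context {R : realType}.

(* The position of [x] relative to the first [n] rationals of an enumeration. *)
Definition rat_code (n : nat) (x : R) : {ffun 'I_n -> bool} :=
  [ffun j : 'I_n => ratr (odflt 0 (unpickle j : option rat)) <= x].

Lemma measurable_rat_code n (b : {ffun 'I_n -> bool}) :
  measurable [set x | rat_code n x = b].
Proof.
have -> : [set x | rat_code n x = b] = \bigcap_(j in [set: 'I_n])
    [set x | (ratr (odflt 0 (unpickle j : option rat)) <= x) = b j].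
  apply/seteqP; split => [x /= <- j _ /=|x /= xb]; first by rewrite ffunE.
  by apply/ffunP => j; rewrite ffunE; exact: xb.
apply: fin_bigcap_measurable => // j _.
set q : R := ratr _.
have mq : measurable [set x : R | q <= x].
  by rewrite (_ : [set x | _] = `[q, +oo[%classic)// set_itvcy.
case: (b j); first exact: mq.
rewrite (_ : [set x | _] = ~` [set x : R | q <= x]); first exact: measurableC.
by apply/seteqP; split => x /=; [move=> ->|move/negP/negbTE].
Qed.

Lemma rat_codeE n (q : rat) (qn : (pickle q < n)%N) (x : R) :
  rat_code n x (Ordinal qn) = (ratr q <= x).
Proof.
by rewrite ffunE (_ : unpickle (Ordinal qn) = Some q)//; exact: pickleK.
Qed.

(** A rational [p] in []x - e, x[] and a rational [q] in []x, x + e[] are both enumerated by stage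
    [N]; from then on, a point with the code of [x] satisfies [p <= y < q]. *)
Lemma rat_code_close (x e : R) : 0 < e ->
  exists N, forall n, (N <= n)%N -> forall y,
    rat_code n y = rat_code n x -> `|x - y| < e.
Proof.
move=> e0.
have [p] : exists p, ratr p \in `]x - e, x[ by apply: rat_in_itvoo; rewrite gtrBl.
rewrite in_itv/= => /andP[p1 p2].
have [q] : exists q, ratr q \in `]x, x + e[ by apply: rat_in_itvoo; rewrite ltrDl.
rewrite in_itv/= => /andP[q1 q2].
exists (maxn (pickle p) (pickle q)).+1 => n; rewrite gtn_max => /andP[pn qn] y.
move=> /ffunP yx; have := yx (Ordinal pn); have := yx (Ordinal qn).
rewrite !rat_codeE (lt_geF q1) (ltW p2) => yq py.
rewrite distrC ltr_norml; apply/andP; split.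
  by rewrite ltrBrDr (lt_le_trans _ py)// addrC.
by rewrite ltrBlDr addrC (lt_trans _ q2)// ltNge yq.
Qed.

Context {d : nat}.

(* Equal to 0 on an empty cell, since [inf set0 = 0]. *)
Definition cell_inf n (g : 'rV[R]_d -> R) (k : {ffun 'I_d -> {ffun 'I_n -> bool}}) :=
  inf [set g y | y in [set y : 'rV[R]_d | forall i, rat_code n (y 0 i) = k i]].

Definition row_code n (x : 'rV[R]_d) : {ffun 'I_d -> {ffun 'I_n -> bool}} :=
  [ffun i => rat_code n (x 0 i)].

Lemma cell_inf_ge0 n (g : 'rV[R]_d -> R) k : (forall x, 0 <= g x) -> 0 <= @cell_inf n g k.
Proof.
move=> g0; rewrite /cell_inf; set E := (X in inf X).
have [->|/set0P E0] := eqVneq E set0; first by rewrite inf0.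
by apply: lb_le_inf => // _ [y _ <-].
Qed.

Lemma cell_inf_le n (g : 'rV[R]_d -> R) x : (forall x, 0 <= g x) ->
  cell_inf g (row_code n x) <= g x.
Proof.
move=> g0; apply: ge_inf; first by exists 0 => _ [y _ <-].
by exists x => // i; rewrite ffunE.
Qed.

(** Finitely many coordinates have a common stage after which the whole cell of [x] lies in a ball
    where [g] exceeds [g x - e]. The infimum is then between [g x - e] and [g x]. *)
Lemma cell_inf_cvg (g : 'rV[R]_d -> R) x : continuous g ->
  cell_inf g (row_code n x) @[n --> \oo] --> g x.
Proof.
move=> cg; apply/cvgrPdist_le => e e0.
have /cvgrPdist_lt/(_ _ e0)/nbhs_ballP[r /= r0 Hr] := cg x.
have close : \forall n \near \oo, forall i y,
    rat_code n y = rat_code n (x 0 i) -> `|x 0 i - y| < r.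
  apply: (filter_forall _ (fun i => _)) => i.
  have [N HN] := rat_code_close (x 0 i) r0.
  by exists N => // n /= Nn y; exact: HN.
apply: filterS close => n close.
have lowb (y : 'rV[R]_d) : (forall i, rat_code n (y 0 i) = row_code n x i) -> g x - e < g y.
  move=> Hy; suff : `|g x - g y| < e.
    by rewrite ltr_norml => /andP[_]; rewrite ltrBlDl -ltrBlDr.
  by apply: Hr; split => // i j; rewrite ord1; apply: close; rewrite Hy ffunE.
have xin : [set g y | y in [set y : 'rV[R]_d |
    forall i, rat_code n (y 0 i) = row_code n x i]] (g x).
  by exists x => // i; rewrite ffunE.
rewrite ger0_norm.
  rewrite lerBlDr -lerBlDl; apply: lb_le_inf; first by exists (g x).
  by move=> _ [y Hy <-]; rewrite ltW// lowb.
(* The values on the cell are bounded below by [g x - e]; no sign of [g] is assumed here. *)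
rewrite subr_ge0; apply: ge_inf => //.
by exists (g x - e) => _ [y Hy <-]; rewrite ltW// lowb.
Qed.

End rational_cells.

(** * From inequalities on boxes to inequalities between integrals *)

Section transfer.
Context {R : realType} {d : nat}.

Section code_integral.
Context {disp : measure_display} {T : measurableType disp}.
Variable X : 'I_d -> T -> R.
Hypothesis mX : forall i, measurable_fun [set: T] (X i).

Definition cell n (k : {ffun 'I_d -> {ffun 'I_n -> bool}}) : set T :=
  [set w | forall i, rat_code n (X i w) = k i].

Lemma measurable_cell n k : measurable (@cell n k).
Proof.
have -> : cell k = \bigcap_(i in [set: 'I_d])
    (X i @^-1` [set x | rat_code n x = k i]).
  by apply/seteqP; split => [w Hw i _|w Hw i]; exact: Hw.
apply: fin_bigcap_measurable => // i _.
by rewrite -[X in measurable X]setTI; apply: mX => //; exact: measurable_rat_code.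
Qed.

Lemma cell_sum n (F : {ffun 'I_d -> {ffun 'I_n -> bool}} -> R) w :
  F (row_code n (\row_i X i w)) = \sum_k F k * \1_(cell k) w.
Proof.
set k0 := row_code n _.
have inc k : (w \in cell k) = (k == k0).
  apply/idP/eqP => [|->]; rewrite inE /cell /=.
    by move=> Hk; apply/ffunP => i; rewrite ffunE mxE Hk.
  by move=> i; rewrite ffunE mxE.
rewrite (bigD1 k0)//= indicE inc eqxx mulr1 big1 ?addr0// => k /negbTE kk0.
by rewrite indicE inc kk0 mulr0.
Qed.

Lemma measurable_row_code n (F : {ffun 'I_d -> {ffun 'I_n -> bool}} -> R) :
  measurable_fun [set: T] (fun w => F (row_code n (\row_i X i w))).
Proof.
under eq_fun do rewrite cell_sum.
apply: measurable_sum => k; apply: measurable_funM => //.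
by apply: measurable_indic; exact: measurable_cell.
Qed.

(** The function is a pointwise limit of simple functions on cells, so measurability of the
    coordinates suffices. *)
Lemma measurable_continuous_row (g : 'rV[R]_d -> R) : continuous g ->
  measurable_fun [set: T] (fun w => g (\row_i X i w)).
Proof.
move=> cg; apply: (@measurable_fun_cvg _ _ _ _
  (fun n w => cell_inf g (row_code n (\row_i X i w)))).
  by move=> n; exact: measurable_row_code.
by move=> w _; exact: cell_inf_cvg.
Qed.

Lemma integral_row_code (mu : {measure set T -> \bar R}) (S : set T) n
    (F : {ffun 'I_d -> {ffun 'I_n -> bool}} -> R) :
  measurable S -> (forall k, 0 <= F k) ->
  (\int[mu]_(w in S) (F (row_code n (\row_i X i w)))%:E =
   \sum_k (F k)%:E * mu (cell k `&` S))%E.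
Proof.
move=> mS F0.
under eq_integral do rewrite cell_sum -sumEFin.
have mI k : measurable_fun S (fun w => (\1_(cell k) w)%:E : \bar R).
  apply: measurable_funTS; apply/measurable_EFinP; apply: measurable_indic.
  exact: measurable_cell.
rewrite ge0_integral_sum//; last 2 first.
- move=> k; apply/measurable_EFinP; apply: measurable_funM => //.
  by apply/measurable_EFinP; exact: mI.
- by move=> k w _; rewrite lee_fin mulr_ge0.
apply: eq_bigr => k _.
under eq_integral do rewrite EFinM.
rewrite ge0_integralZl//; first by rewrite integral_indic//; exact: measurable_cell.
by rewrite lee_fin.
Qed.

End code_integral.

(** Cells are boxes, so the hypothesis compares the integrals of the cell infima term by term. On
    the right these infima are at most [g]; on the left Fatou's lemma recovers [g]. *)
Lemma ge0_integral_row_le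
    (disp disp' : measure_display) (T : measurableType disp)
    (T' : measurableType disp') (mu : {measure set T -> \bar R})
    (nu : {measure set T' -> \bar R}) (X : 'I_d -> T -> R) (Y : 'I_d -> T' -> R)
    (S : set T) (c : R) (g : 'rV[R]_d -> R) :
  (forall i, measurable_fun [set: T] (X i)) ->
  (forall i, measurable_fun [set: T'] (Y i)) ->
  measurable S -> 0 <= c ->
  (forall A : 'I_d -> set R, (forall i, measurable (A i)) ->
    (mu ([set w | forall i, A i (X i w)] `&` S) <=
     c%:E * nu [set w | forall i, A i (Y i w)])%E) ->
  continuous g -> (forall x, 0 <= g x) ->
  (\int[mu]_(w in S) (g (\row_i X i w))%:E <=
   c%:E * \int[nu]_w (g (\row_i Y i w))%:E)%E.
Proof.
move=> mX mY mS c0 XY cg g0.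
pose gX n w := (cell_inf g (row_code n (\row_i X i w)))%:E.
have step n : (\int[mu]_(w in S) gX n w <=
    c%:E * \int[nu]_w (g (\row_i Y i w))%:E)%E.
  rewrite /gX integral_row_code//; last by move=> k; exact: cell_inf_ge0.
  apply: (@le_trans _ _ (c%:E *
      \int[nu]_w (cell_inf g (row_code n (\row_i Y i w)))%:E)%E).
    rewrite integral_row_code//; last by move=> k; exact: cell_inf_ge0.
    rewrite ge0_sume_distrr; last first.
      by move=> k _; rewrite mule_ge0// lee_fin cell_inf_ge0.
    apply: lee_sum => k _; rewrite muleCA lee_wpmul2l//.
      by rewrite lee_fin cell_inf_ge0.
    rewrite setIT; apply: (XY (fun i => [set x | rat_code n x = k i])) => i.
    exact: measurable_rat_code.
  rewrite lee_wpmul2l ?lee_fin//; apply: ge0_le_integral => //.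
  - by move=> w _; rewrite lee_fin cell_inf_ge0.
  - by apply/measurable_EFinP; exact: measurable_row_code.
  - by apply/measurable_EFinP; exact: measurable_continuous_row.
  - by move=> w _; rewrite lee_fin cell_inf_le.
have lim_g w : limn_einf (gX ^~ w) = (g (\row_i X i w))%:E.
  have /cvg_lim : gX ^~ w @ \oo --> (g (\row_i X i w))%:E.
    apply: cvg_EFin; first exact: nearW.
    exact: cell_inf_cvg.
  move=> <-//; apply: is_cvg_limn_einfE; apply/cvg_ex.
  exists (g (\row_i X i w))%:E; apply: cvg_EFin; first exact: nearW.
  exact: cell_inf_cvg.
have := @fatou _ _ _ mu S mS gX _ _.
under eq_integral do rewrite lim_g.
move=> /(_ _ _)/le_trans; apply.
- by move=> n; apply: measurable_funTS; apply/measurable_EFinP; exact: measurable_row_code.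
- by move=> n w _; rewrite lee_fin cell_inf_ge0.
(* The lower limit is the limit of the infima over tails, and each of them is at most its first
   term, bounded by [step]. *)
rewrite limn_einf_lim; apply: lime_le; first exact: is_cvg_einfs.
apply: nearW => n; apply: le_trans (step n).
by apply: ereal_inf_lbound; exists n => /=.
Qed.

End transfer.

(** * Isotropic Gaussian vectors *)

Section gaussian_vector.
Context {R : realType} {d : nat} {disp : measure_display} {T : measurableType disp}.
Variables (P : probability T R) (X : 'I_d -> {RV P >-> R}) (s : R).
Hypotheses (s_gt0 : 0 < s) (gX : isotropic_gaussian X s).

Lemma isotropic_gaussian_box (A : 'I_d -> set R) : (forall i, measurable (A i)) ->
  P [set w | forall i, A i (X i w)] = (\prod_(i < d) normal_prob 0 s (A i))%E.
Proof.
move=> mA; have [indep law] := gX.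
have := indep [set: 'I_d]%SET A mA.
rewrite (_ : [set w | _] = [set w | forall i, A i (X i w)]); last first.
  by apply/seteqP; split => w /= H i *; apply: H; rewrite ?inE.
move=> ->; apply: eq_big => [i|i _]; first by rewrite inE.
exact: (law i (A i) (mA i)).
Qed.

Let mX i : measurable_fun [set: T] (X i).
Proof. exact: measurable_funP. Qed.

Lemma gaussian_second_moment k : (\int[P]_w (X k w ^+ 2)%:E = (s ^+ 2)%:E)%E.
Proof.
have [_ law] := gX.
rewrite -(second_moment_normal_prob s_gt0).
have msq : measurable_fun [set: measurableTypeR R] (fun x : R => (x ^+ 2)%:E).
  by apply/measurable_EFinP; exact: exprn_measurable.
(* [normal_prob] lives on [measurableTypeR R], random variables on [R] itself:
   the two structures have different displays. *)
have mXk : @measurable_fun _ _ T (measurableTypeR R) setT (X k) by exact: mX.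
have E := @ge0_integral_pushforward _ _ T (measurableTypeR R) R _ mXk P _ _
  measurableT msq.
rewrite -[LHS]E; last by move=> x _; rewrite lee_fin sqr_ge0.
by apply: eq_measure_integral => A mA _; exact: law.
Qed.

Definition flip (k : 'I_d) (x : 'rV[R]_d) : 'rV[R]_d :=
  \row_i (if i == k then - x 0 i else x 0 i).

Let Y (k : 'I_d) (i : 'I_d) (w : T) : R := if i == k then - X i w else X i w.

Let mY k i : measurable_fun [set: T] (Y k i).
Proof.
rewrite /Y; case: eqP => _; last exact: mX.
by apply: measurableT_comp => //; exact: mX.
Qed.

Let box_flip k (A : 'I_d -> set R) : (forall i, measurable (A i)) ->
  P [set w | forall i, A i (Y k i w)] = P [set w | forall i, A i (X i w)].
Proof.
move=> mA.
(* The sign change moves from the variable to the [k]-th side of the box, whose normal probability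
   is invariant under reflection. *)
pose A' i := if i == k then (-%R : R -> R) @^-1` A i else A i.
rewrite (_ : [set w | forall i, A i (Y k i w)] =
    [set w | forall i, A' i (X i w)]); last first.
  by apply/seteqP; split => w /= H i; have := H i; rewrite /Y /A'; case: eqP.
have mA' i : measurable (A' i).
  rewrite /A'; case: eqP => // _.
  by rewrite -[X in measurable X]setTI; apply: oppr_measurable.
rewrite !isotropic_gaussian_box//; apply: eq_bigr => i _; rewrite /A'.
by case: eqP => // _; rewrite normal_probN ?gt_eqF.
Qed.

Lemma ge0_integral_flip k (g : 'rV[R]_d -> R) : continuous g ->
  (forall x, 0 <= g x) ->
  (\int[P]_w (g (rvec X w))%:E = \int[P]_w (g (flip k (rvec X w)))%:E)%E.
Proof.
move=> cg g0.
have -> : (\int[P]_w (g (flip k (rvec X w)))%:E =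
    \int[P]_w (g (\row_i Y k i w))%:E)%E.
  apply: eq_integral => w _; congr (g _)%:E; apply/rowP => i.
  by rewrite !mxE.
(* Equality follows from the transfer inequality in both directions, with [c = 1] on the whole
   space. *)
apply/eqP; rewrite eq_le -[leRHS]mul1e -[X in _ && (_ <= X)%E]mul1e.
apply/andP; split; apply: ge0_integral_row_le => // A mA;
    rewrite setIT mul1e le_eqVlt; apply/orP; left; apply/eqP.
  exact: esym (box_flip k mA).
exact: box_flip.
Qed.

Lemma integral_odd_flip k (h : 'rV[R]_d -> R) : continuous h ->
  (forall x, h (flip k x) = - h x) ->
  P.-integrable [set: T] (fun w => (h (rvec X w))%:E) ->
  (\int[P]_w (h (rvec X w))%:E = 0)%E.
Proof.
move=> ch hN hi.
have ca : continuous (fun x => `|h x|).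
  by move=> x; apply: (cvg_comp _ _ (ch x)); exact: norm_continuous.
have ai : P.-integrable [set: T] (fun w => `|h (rvec X w)|%:E).
  exact: (integrable_norm hi).
(* [`|h| + h] is nonnegative, and the flip turns it into [`|h| - h]. *)
have cha : continuous (fun x => `|h x| + h x).
  by move=> x; exact: (cvgD (ca x) (ch x)).
have ge0 x : 0 <= `|h x| + h x by rewrite -lerBlDr sub0r ler_normr lexx orbT.
have := ge0_integral_flip k cha ge0.
rewrite (_ : (\int[P]_w (`|h (flip k (rvec X w))| + h (flip k (rvec X w)))%:E =
    \int[P]_w (`|h (rvec X w)| - h (rvec X w))%:E)%E); last first.
  by apply: eq_integral => w _; rewrite hN normrN.
have -> : (\int[P]_w (`|h (rvec X w)| + h (rvec X w))%:E =
    \int[P]_w `|h (rvec X w)|%:E + \int[P]_w (h (rvec X w))%:E)%E.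
  by under eq_integral do rewrite EFinD; rewrite integralD.
have -> : (\int[P]_w (`|h (rvec X w)| - h (rvec X w))%:E =
    \int[P]_w `|h (rvec X w)|%:E - \int[P]_w (h (rvec X w))%:E)%E.
  by under eq_integral do rewrite EFinB; rewrite integralB.
have fa := integrable_fin_num measurableT ai.
have fh := integrable_fin_num measurableT hi.
rewrite -(fineK fa) -(fineK fh) -EFinD -EFinB => -[] /addrI E.
by congr EFin; move: E; move: (fine (\int[P]_w (h (rvec X w))%:E)) => z; lra.
Qed.

Lemma gaussian_integrable_sqr k :
  P.-integrable [set: T] (fun w => (X k w ^+ 2)%:E).
Proof.
apply/integrableP; split.
  by apply/measurable_EFinP; apply: measurable_funX; exact: mX.
under eq_integral do rewrite gee0_abs ?lee_fin ?sqr_ge0//.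
by rewrite gaussian_second_moment ltry.
Qed.

Lemma gaussian_integrable1 k : P.-integrable [set: T] (fun w => (X k w)%:E).
Proof.
apply: (@le_integrable _ _ _ P _ measurableT _ (fun w => 1%:E + (X k w ^+ 2)%:E)%E).
- by apply/measurable_EFinP; exact: mX.
- move=> w _; rewrite -EFinD /= lee_fin.
  rewrite [leRHS]ger0_norm ?addr_ge0 ?sqr_ge0//.
  rewrite -(real_normK (num_real (X k w))).
  (* This sum of squares is twice [1 + y ^+ 2 - y]. *)
  move: `|X k w| => y; have : 0 <= (y - 1) ^+ 2 + y ^+ 2 + 1.
    by rewrite !addr_ge0 ?sqr_ge0.
  nra.
apply: integrableD => //; last exact: gaussian_integrable_sqr.
exact: finite_measure_integrable_cst.
Qed.

Lemma gaussian_integrable2 j k :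
  P.-integrable [set: T] (fun w => (X j w * X k w)%:E).
Proof.
apply: (@le_integrable _ _ _ P _ measurableT _
  (fun w => (X j w ^+ 2)%:E + (X k w ^+ 2)%:E)%E).
- by apply/measurable_EFinP; apply: measurable_funM; exact: mX.
- move=> w _; rewrite -EFinD /= lee_fin.
  rewrite [leRHS]ger0_norm ?addr_ge0 ?sqr_ge0// normrM.
  rewrite -(real_normK (num_real (X j w))) -(real_normK (num_real (X k w))).
  move: `|X k w| `|X j w| => y z; have : 0 <= (z - y) ^+ 2 + z ^+ 2 + y ^+ 2.
    by rewrite !addr_ge0 ?sqr_ge0.
  nra.
by apply: integrableD => //; exact: gaussian_integrable_sqr.
Qed.

Lemma gaussian_mean k : (\int[P]_w (X k w)%:E = 0)%E.
Proof.
have E w : X k w = rvec X w 0 k by rewrite mxE.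
under eq_integral do rewrite E.
apply: (@integral_odd_flip k (fun x => x 0 k)).
- exact: coord_continuous.
- by move=> x; rewrite mxE eqxx.
- by under eq_fun do rewrite -E; exact: gaussian_integrable1.
Qed.

(** Off the diagonal, flipping coordinate [k] alone changes the sign of the product, so its mean
    vanishes. *)
Lemma gaussian_covariance j k :
  (\int[P]_w (X j w * X k w)%:E = (s ^+ 2 *+ (j == k))%:E)%E.
Proof.
have [->|jk] := eqVneq j k.
  by under eq_integral do rewrite -expr2; exact: gaussian_second_moment.
have E w : X j w * X k w = rvec X w 0 j * rvec X w 0 k by rewrite !mxE.
under eq_integral do rewrite E.
apply: (@integral_odd_flip k (fun x => x 0 j * x 0 k)).
- move=> x; exact: (cvgM (@coord_continuous _ _ _ 0 j x) (@coord_continuous _ _ _ 0 k x)).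
- by move=> x; rewrite !mxE eqxx (negbTE jk) mulrN.
- by under eq_fun do rewrite -E; exact: gaussian_integrable2.
Qed.

End gaussian_vector.

(** * Gaussian vectors at two scales, and means of quadratic polynomials *)

Section gaussian_expansion.
Context {R : realType} {d : nat}.

Lemma lee_prod_ord n (f g : 'I_n -> \bar R) : (forall i, (0 <= f i <= g i)%E) ->
  (\prod_(i < n) f i <= \prod_(i < n) g i)%E.
Proof.
move=> fg; have : (0 <= \prod_(i < n) f i <= \prod_(i < n) g i)%E.
  apply: (big_ind2 (fun x y => (0 <= x <= y)%E)) => //; first by rewrite lee01 lexx.
  move=> x1 x2 y1 y2 /andP[x10 x12] /andP[y10 y12].
  by rewrite mule_ge0//= lee_pmul.
by case/andP.
Qed.

(** For [0 < s <= t] and [0 <= r], the maximal ratio on [r <= |x|] of the centred normal densities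
    with deviations [s] and [t]; it is [t / s] when [r = 0]. *)
Definition tail_factor (s t r : R) : R :=
  t / s * expR (- (r ^+ 2 / 2 * (s ^- 2 - t ^- 2))).

(** A box cut by the coordinate thresholds is again a box, so its probability factors and each
    factor obeys the one-dimensional comparison. Zero thresholds give a global domination, one
    positive threshold a bound on a slab. *)
Lemma gaussian_integral_le (disp disp' : measure_display)
    (T : measurableType disp) (T' : measurableType disp')
    (P : probability T R) (Q : probability T' R)
    (X : 'I_d -> {RV P >-> R}) (Y : 'I_d -> {RV Q >-> R}) (s t : R)
    (r : 'I_d -> R) (g : 'rV[R]_d -> R) :
  0 < s <= t -> isotropic_gaussian X s -> isotropic_gaussian Y t ->
  (forall i, 0 <= r i) -> continuous g -> (forall x, 0 <= g x) ->
  (\int[P]_(w in [set w | forall i, (r i <= `|X i w|)%R]) (g (rvec X w))%:E <=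
   (\prod_(i < d) tail_factor s t (r i))%:E * \int[Q]_w (g (rvec Y w))%:E)%E.
Proof.
move=> st gX gY r0 cg g0; have /andP[s0 s_le_t] := st.
have t0 : 0 < t := lt_le_trans s0 s_le_t.
have mtail i : measurable [set x : R | r i <= `|x|].
  rewrite -[X in measurable X]setTI.
  have := @normr_measurable R setT measurableT `[r i, +oo[%classic.
  by rewrite set_itvcy/=; apply; rewrite -set_itvcy.
have mX i : measurable_fun [set: T] (X i) by exact: measurable_funP.
have mY i : measurable_fun [set: T'] (Y i) by exact: measurable_funP.
apply: ge0_integral_row_le => //.
- rewrite (_ : [set w | _] = \bigcap_(i in [set: 'I_d])
      (X i @^-1` [set x : R | r i <= `|x|])); last first.
    by apply/seteqP; split => [w Hw i _|w Hw i]; exact: Hw.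
  apply: fin_bigcap_measurable => // i _.
  by rewrite -[X in measurable X]setTI; exact: mX.
- by apply: prodr_ge0 => i _; rewrite mulr_ge0 ?expR_ge0// divr_ge0 ?ltW.
have eqle (x y : \bar R) : x = y -> (x <= y)%E by move=> ->.
move=> A mA; pose A' i := A i `&` [set x : R | r i <= `|x|].
have mA' i : measurable (A' i) by exact: measurableI.
have -> : [set w | forall i, A i (X i w)] `&` [set w | forall i, r i <= `|X i w|] =
    [set w | forall i, A' i (X i w)].
  apply/seteqP; split => w /=; first by move=> [H1 H2] i; split; [exact: H1|exact: H2].
  by move=> H; split => i; have [] := H i.
apply: le_trans (_ : ((\prod_(i < d) normal_prob 0 s (A' i)) <= _)%E).
  by exact: eqle (isotropic_gaussian_box gX mA').
apply: (@le_trans _ _ ((\prod_(i < d) tail_factor s t (r i))%:E *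
    \prod_(i < d) normal_prob 0 t (A i))%E); last first.
  apply: eqle; congr (_ * _)%E.
  exact: esym (isotropic_gaussian_box gY mA).
rewrite -prodEFin -big_split/=; apply: lee_prod_ord => i.
rewrite measure_ge0/=.
have tl x : A' i x -> r i <= `|x| by case.
apply: le_trans (normal_prob_le st (r0 i) (mA' i) tl) _.
rewrite lee_wpmul2l//.
  by rewrite lee_fin mulr_ge0 ?expR_ge0// divr_ge0 ?ltW.
apply: le_measure; rewrite ?inE; [exact: mA'|exact: mA|exact: subIsetl].
Qed.

Definition quadratic (b0 : R) (b : 'I_d -> R) (H : 'I_d -> 'I_d -> R)
    (x : 'rV[R]_d) : R :=
  b0 + (\sum_(k < d) x 0 k * b k
    + 2^-1 * \sum_(j < d) \sum_(k < d) x 0 j * x 0 k * H j k).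

Lemma gaussian_quadratic (disp : measure_display) (T : measurableType disp)
    (P : probability T R) (X : 'I_d -> {RV P >-> R}) (s : R) b0 b H :
  0 < s -> isotropic_gaussian X s ->
  P.-integrable [set: T] (fun w => (quadratic b0 b H (rvec X w))%:E) /\
  (\int[P]_w (quadratic b0 b H (rvec X w))%:E =
    (b0 + s ^+ 2 * (2^-1 * \sum_(k < d) H k k))%:E)%E.
Proof.
move=> s0 gX.
have E w : (quadratic b0 b H (rvec X w))%:E = (b0%:E +
    (\sum_(k < d) (b k)%:E * (X k w)%:E +
     (2^-1)%:E * \sum_(j < d) \sum_(k < d) (H j k)%:E * (X j w * X k w)%:E))%E.
  rewrite /quadratic !EFinD EFinM -!sumEFin; congr (_ + (_ + _ * _))%E.
    by apply: eq_bigr => k _; rewrite mxE EFinM muleC.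
  apply: eq_bigr => j _; rewrite -sumEFin; apply: eq_bigr => k _.
  by rewrite !mxE EFinM muleC.
have i0 : P.-integrable [set: T] (cst b0%:E).
  exact: finite_measure_integrable_cst.
have i1 k : P.-integrable [set: T] (fun w => (b k)%:E * (X k w)%:E)%E.
  by apply: integrableZl => //; exact: gaussian_integrable1 gX k.
have i2 j k : P.-integrable [set: T] (fun w => (H j k)%:E * (X j w * X k w)%:E)%E.
  by apply: integrableZl => //; exact: gaussian_integrable2 gX j k.
have j1 : P.-integrable [set: T] (fun w => \sum_(k < d) (b k)%:E * (X k w)%:E)%E.
  by apply: integrable_sum => // k _; exact: i1.
have j2 j : P.-integrable [set: T]
    (fun w => \sum_(k < d) (H j k)%:E * (X j w * X k w)%:E)%E.
  by apply: integrable_sum => // k _; exact: i2.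
have j3 : P.-integrable [set: T]
    (fun w => \sum_(j < d) \sum_(k < d) (H j k)%:E * (X j w * X k w)%:E)%E.
  by apply: integrable_sum => // j _; exact: j2.
have j4 : P.-integrable [set: T] (fun w => (2^-1)%:E *
    \sum_(j < d) \sum_(k < d) (H j k)%:E * (X j w * X k w)%:E)%E.
  exact: integrableZl.
have j5 := integrableD measurableT j1 j4.
split.
  by under eq_fun do rewrite E; exact: (integrableD measurableT i0 j5).
under eq_integral do rewrite E.
rewrite integralD// integral_cst//= probability_setT mule1.
rewrite integralD// integral_sum//.
rewrite big1; last first.
  move=> k _; rewrite integralZl//; last exact: gaussian_integrable1 gX k.
  by rewrite (gaussian_mean s0 gX) mule0.
rewrite add0e integralZl// integral_sum//.
rewrite (eq_bigr (fun j => (s ^+ 2 * H j j)%:E)); last first.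
  move=> j _; rewrite integral_sum//.
  rewrite (eq_bigr (fun k => (H j k * (s ^+ 2 *+ (j == k)))%:E)); last first.
    move=> k _; rewrite integralZl//; last exact: gaussian_integrable2 gX j k.
    by rewrite (gaussian_covariance s0 gX) EFinM.
  rewrite sumEFin (bigD1 j)//= eqxx mulr1n big1 ?addr0 1?mulrC// => k.
  by rewrite eq_sym => /negbTE ->; rewrite mulr0n mulr0.
by rewrite sumEFin -EFinM -EFinD -mulr_sumr mulrCA.
Qed.

(** The max norm is at most the Euclidean norm. *)
Lemma sqr_norm_le (x : 'rV[R]_d) : `|x| ^+ 2 <= \sum_(k < d) x 0 k ^+ 2.
Proof.
have S0 : 0 <= \sum_(k < d) x 0 k ^+ 2 by apply: sumr_ge0 => k _; exact: sqr_ge0.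
rewrite -[leRHS]sqr_sqrtr// ler_pXn2r// ?nnegrE ?sqrtr_ge0//.
apply: norm_le_coord; first exact: sqrtr_ge0.
move=> i; rewrite -sqrtr_sqr ler_sqrt// (bigD1 i)//= lerDl.
by apply: sumr_ge0 => k _; exact: sqr_ge0.
Qed.

End gaussian_expansion.

(** * The remainder *)

Section gaussian_remainder.
Context {R : realType} {d : nat}.

Definition single (k : 'I_d) (r : R) (i : 'I_d) : R := if i == k then r else 0.

Lemma prod_tail_factor (k : 'I_d) (s t r : R) :
  \prod_(i < d) tail_factor s t (single k r i) =
  (t / s) ^+ d * expR (- (r ^+ 2 / 2 * (s ^- 2 - t ^- 2))).
Proof.
rewrite big_split/= prodr_const card_ord; congr (_ * _).
rewrite (bigD1 k)//= /single eqxx big1 ?mulr1// => i /negbTE ->.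
by rewrite expr0n/= !mul0r oppr0 expR0.
Qed.

(* [expR (- y) <= m`! / y ^+ m] with [m = d.+2] beats the powers of [s]. *)
Lemma cvg_tail_factor (t r : R) : 0 < t -> 0 < r ->
  ((t / s) ^+ d * expR (- (r ^+ 2 / 2 * (s ^- 2 - t ^- 2))) / s ^+ 2)
    @[s --> (0 : R)^'+] --> (0 : R).
Proof.
move=> t0 r0; have : 0 < r ^+ 2 / 2 by rewrite divr_gt0// exprn_gt0.
move: (r ^+ 2 / 2) => a a0.
(* With [y = a * s ^- 2], the factor [y ^- d.+2] brings [s] to the power [2 * d.+2]. The divisions
   by [s ^+ d] and [s ^+ 2] use up half of it, and [K] collects what does not depend on [s]. *)
pose K := t ^+ d * expR (a * t ^- 2) * (d.+2`!%:R / a ^+ d.+2).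
apply: (@squeeze_cvgr _ _ _ _ (cst 0) (fun s => K * s ^+ d.+2)).
- near=> s.
  have s0 : 0 < s by near: s; exact: nbhs_right_gt.
  apply/andP; split.
    by rewrite divr_ge0 ?sqr_ge0// mulr_ge0 ?expR_ge0// exprn_ge0// divr_ge0 ?ltW.
  rewrite mulrBr opprB expRD.
  pose y := a * s ^- 2.
  have y0 : 0 < y by rewrite mulr_gt0// invr_gt0 exprn_gt0.
  have ey : expR (- y) <= d.+2`!%:R / y ^+ d.+2.
    rewrite expRN -[leRHS]invrK lef_pV2 ?posrE ?expR_gt0//; last first.
      by rewrite invr_gt0 divr_gt0 ?exprn_gt0// ltr0n fact_gt0.
    rewrite invf_div (le_trans _ (expR_ge1Dxn d.+1 (ltW y0)))//.
    by rewrite lerDr.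
  have -> : K * s ^+ d.+2 =
      (t / s) ^+ d * (expR (a * t ^- 2) * (d.+2`!%:R / y ^+ d.+2)) / s ^+ 2.
    rewrite /K /y !expr_div_n [(s ^+ 2) ^+ _]exprAC.
    rewrite (_ : s ^+ d.+2 = s ^+ d * s ^+ 2); last by rewrite -exprD addn2.
    have sd0 : s ^+ d != 0 by rewrite expf_neq0// gt_eqF.
    have aN0 : a ^+ d.+2 != 0 by rewrite expf_neq0// gt_eqF.
    have sn0 := lt0r_neq0 s0.
    move: (s ^+ d) (a ^+ d.+2) (d.+2`!%:R : R) (expR _) (t ^+ d) sd0 aN0.
    by move=> sd aN f e td sd0 aN0; field; rewrite ?sd0 ?aN0 ?sn0.
  rewrite ler_pM2r ?invr_gt0 ?exprn_gt0// ler_pM2l ?exprn_gt0 ?divr_gt0//.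
  by rewrite ler_pM2l ?expR_gt0.
- exact: cvg_cst.
- have pow : s ^+ d.+2 @[s --> (0 : R)^'+] --> (0 : R).
    have : s ^+ d.+2 @[s --> (0 : R)^'+] --> (0 : R) ^+ d.+2.
      by apply: cvg_at_right_filter; exact: (@exprn_continuous R d.+2 0).
    by rewrite exprS mul0r.
  have KP : (fun s : R => K * s ^+ d.+2) @ (0 : R)^'+ --> K * 0.
    exact: (cvgM (cvg_cst K) pow).
  by move: KP; rewrite mulr0.
Unshelve. all: by end_near. Qed.

End gaussian_remainder.

(** * Decay of the remainder as the scale tends to 0 *)

Section gaussian_remainder_limit.
Context {R : realType} {d : nat} {disp : measure_display}.
Variables (Omega : R -> measurableType disp)
  (P : forall eta : R, probability (Omega eta) R)
  (eps : forall eta : R, 'I_d -> {RV (P eta) >-> R}).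
Hypothesis gaussian : forall eta : R, 0 < eta -> isotropic_gaussian (eps eta) eta.
Variables (g : 'rV[R]_d -> R) (t : R).
Hypotheses (cg : continuous g) (g_ge0 : forall x, 0 <= g x) (t_gt0 : 0 < t).
Hypothesis g_fin : (\int[P t]_w (g (rvec (eps t) w))%:E < +oo)%E.

Let mE (s : R) (h : 'rV[R]_d -> R) : continuous h ->
  measurable_fun [set: Omega s] (fun w => h (rvec (eps s) w)).
Proof.
by move=> ch; apply: measurable_continuous_row => // i; exact: measurable_funP.
Qed.

(** Comparison with zero thresholds bounds the mean at scale [s] by [(t / s) ^+ d] times the finite
    mean at scale [t]. *)
Lemma gaussian_integrable_le (s : R) : 0 < s <= t ->
  (P s).-integrable [set: Omega s] (fun w => (g (rvec (eps s) w))%:E).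
Proof.
move=> st; apply/integrableP; split; first by apply/measurable_EFinP; exact: mE.
under eq_integral do rewrite gee0_abs ?lee_fin ?g_ge0//.
have /andP[s0 _] := st.
have := gaussian_integral_le (r := fun=> 0) st (gaussian s0) (gaussian t_gt0)
  (fun=> lexx _) cg g_ge0.
rewrite (_ : [set w | _] = setT); last by apply/seteqP; split => // w _ i.
move=> /le_lt_trans; apply; rewrite -ge0_fin_numE; last first.
  rewrite mule_ge0 ?integral_ge0//.
    rewrite lee_fin prodr_ge0// => i _.
    by rewrite mulr_ge0 ?expR_ge0// divr_ge0// ltW.
  by move=> w _; rewrite lee_fin.
rewrite fin_numM// ge0_fin_numE//; apply: integral_ge0 => w _.
by rewrite lee_fin.
Qed.

Variables (b0 : R) (b : 'I_d -> R) (H : 'I_d -> 'I_d -> R).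
Let q := quadratic b0 b H.

Hypothesis peano : forall e : R, 0 < e -> exists2 r : R, 0 < r &
  forall x, `|x| < r -> `|g x - q x| <= e * `|x| ^+ 2.

Let cq : continuous q.
Proof.
have cc (k : 'I_d) : class_C 0 (fun x : 'rV[R]_d => x 0 k).
  exact: coord_continuous.
have cst (c : R) : class_C 0 (fun _ : 'rV[R]_d => c) by exact: cst_continuous.
apply: (@class_CD R d 0) => //; apply: (@class_CD R d 0).
  by apply: class_C_sum => k; exact: class_CM.
apply: class_CM => //; apply: class_C_sum => j; apply: class_C_sum => k.
by apply: class_CM => //; exact: class_CM.
Qed.

Let f x := `|g x - q x|.

Let cf : continuous f.
Proof.
have cd : continuous (fun x => g x - q x) by exact: (@class_CB R d 0).
by move=> x; apply: (cvg_comp _ _ (cd x)); exact: norm_continuous.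
Qed.

Let integrable_diff (s : R) : 0 < s <= t ->
  (P s).-integrable [set: Omega s] (fun w => (g (rvec (eps s) w))%:E
    - (q (rvec (eps s) w))%:E)%E.
Proof.
move=> st; have /andP[s0 _] := st.
apply: integrableB => //; first exact: gaussian_integrable_le.
by have [] := gaussian_quadratic b0 b H s0 (gaussian s0).
Qed.

Let M := fine (\int[P t]_w (f (rvec (eps t) w))%:E).

Let int_f : (\int[P t]_w (f (rvec (eps t) w))%:E = M%:E)%E.
Proof.
have tt : 0 < t <= t by rewrite t_gt0 lexx.
have /integrable_abse/integrable_fin_num := integrable_diff tt.
by move=> F; rewrite /M fineK//; exact: F.
Qed.

Definition gaussian_rem (s : R) : R :=
  fine (\int[P s]_w (g (rvec (eps s) w))%:E)
  - (b0 + s ^+ 2 * (2^-1 * \sum_(k < d) H k k)).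

Lemma gaussian_remE (s : R) : 0 < s <= t ->
  (\int[P s]_w (g (rvec (eps s) w))%:E =
   (b0 + s ^+ 2 * (2^-1 * \sum_(k < d) H k k) + gaussian_rem s)%:E)%E.
Proof.
move=> st; have F := integrable_fin_num measurableT (gaussian_integrable_le st).
by rewrite -[LHS]fineK//; congr EFin; rewrite /gaussian_rem addrC subrK.
Qed.

(** The mean of [q] is exact, so the remainder is the mean of [g - q]. Near 0 the Peano bound costs
    at most [e] times the sum of the [d] second moments; elsewhere the point is in one of [d] slabs,
    each compared with scale [t]. *)
Lemma gaussian_rem_le (e r s : R) : 0 < e -> 0 < r ->
  (forall x, `|x| < 2 * r -> `|g x - q x| <= e * `|x| ^+ 2) -> 0 < s <= t ->
  `|gaussian_rem s| <= e * (d%:R * s ^+ 2) + d%:R *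
    ((t / s) ^+ d * expR (- (r ^+ 2 / 2 * (s ^- 2 - t ^- 2))) * M).
Proof.
move=> e0 r0 near_bound st; have /andP[s0 _] := st.
set C := (t / s) ^+ d * _.
have [iq Eq] := gaussian_quadratic b0 b H s0 (gaussian s0).
have ig := gaussian_integrable_le st.
pose S k := [set w : Omega s | forall i, single k r i <= `|eps s i w|].
have mS k : measurable (S k).
  rewrite (_ : S k = \bigcap_(i in [set: 'I_d])
      (eps s i @^-1` [set x : R | single k r i <= `|x|])); last first.
    by apply/seteqP; split => [w Hw i _|w Hw i]; exact: Hw.
  apply: fin_bigcap_measurable => // i _.
  rewrite -[X in measurable X]setTI; apply: (measurable_funP (eps s i)) => //.
  rewrite -[X in measurable X]setTI.
  have := @normr_measurable R setT measurableT `[single k r i, +oo[%classic.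
  by rewrite set_itvcy/=; apply; rewrite -set_itvcy.
have tail k : (\int[P s]_(w in S k) (f (rvec (eps s) w))%:E <= (C * M)%:E)%E.
  rewrite EFinM -int_f /C -(prod_tail_factor k).
  have single_ge0 i : 0 <= single k r i.
    by rewrite /single; case: eqP => // _; exact: ltW.
  have f_ge0 x : 0 <= f x by exact: normr_ge0.
  exact: (gaussian_integral_le st (gaussian s0) (gaussian t_gt0) single_ge0 cf
    f_ge0).
(* Either all coordinates are below [r], or the point lies in some slab [S k]. *)
have pointwise w : ((f (rvec (eps s) w))%:E <=
    \sum_(k < d) e%:E * (eps s k w ^+ 2)%:E +
    \sum_(k < d) ((fun w => (f (rvec (eps s) w))%:E) \_ (S k)) w)%E.
  have sq_ge0 : (0 <= \sum_(k < d) e%:E * (eps s k w ^+ 2)%:E)%E.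
    by apply: sume_ge0 => k _; rewrite lee_fin mulr_ge0 ?sqr_ge0 ?ltW.
  have p_ge0 k : (0 <= ((fun w => (f (rvec (eps s) w))%:E) \_ (S k)) w)%E.
    by rewrite patchE; case: ifP => // _; rewrite lee_fin normr_ge0.
  have [small|] := pselect (forall k, `|eps s k w| < r).
    rewrite -[leLHS]adde0 leeD//; last exact: sume_ge0.
    rewrite (eq_bigr (fun k => (e * (eps s k w ^+ 2))%:E)) // sumEFin lee_fin.
    rewrite -mulr_sumr.
    apply: (@le_trans _ _ (e * `|rvec (eps s) w| ^+ 2)).
      (* [norm_le_coord] gives only a weak inequality by [r]; the radius [2 * r] makes it strict. *)
      apply: near_bound; apply: (@le_lt_trans _ _ r).
        apply: norm_le_coord; first exact: ltW.
        by move=> i; rewrite mxE ltW.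
      by rewrite ltr_pMl// ltr1n.
    rewrite ler_wpM2l ?(ltW e0)//; apply: le_trans (sqr_norm_le _) _.
    by apply: ler_sum => k _; rewrite mxE.
  move=> /existsNP[k /negP]; rewrite -leNgt => rk.
  rewrite -[leLHS]add0e leeD// (bigD1 k)//= -[leLHS]adde0 leeD//; last first.
    exact: sume_ge0.
  rewrite patchE ifT// inE /S /= => i; rewrite /single.
  by case: eqP => // ->.
have mf : measurable_fun [set: Omega s] (fun w => (f (rvec (eps s) w))%:E).
  by apply/measurable_EFinP; exact: mE.
have msq k : measurable_fun [set: Omega s] (fun w => e%:E * (eps s k w ^+ 2)%:E)%E.
  apply/measurable_EFinP; apply: measurable_funM => //.
  by apply: measurable_funX; exact: measurable_funP.
have mp k : measurable_fun [set: Omega s]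
    ((fun w => (f (rvec (eps s) w))%:E) \_ (S k)).
  by apply/(measurable_restrictT _ (mS k)); apply: measurable_funTS; exact: mf.
have msum1 : measurable_fun [set: Omega s]
    (fun w => \sum_(k < d) e%:E * (eps s k w ^+ 2)%:E)%E.
  by apply: emeasurable_sum => k; exact: msq.
have msum2 : measurable_fun [set: Omega s]
    (fun w => \sum_(k < d) ((fun w => (f (rvec (eps s) w))%:E) \_ (S k)) w)%E.
  by apply: emeasurable_sum => k; exact: mp.
have int_bound : (\int[P s]_w (f (rvec (eps s) w))%:E <=
    (e * (d%:R * s ^+ 2) + d%:R * (C * M))%:E)%E.
  apply: (@le_trans _ _ (\int[P s]_w (\sum_(k < d) e%:E * (eps s k w ^+ 2)%:E +
    \sum_(k < d) ((fun w => (f (rvec (eps s) w))%:E) \_ (S k)) w))%E).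
    apply: ge0_le_integral => //.
    - by move=> w _; rewrite lee_fin normr_ge0.
    - exact: emeasurable_funD msum1 msum2.
  rewrite ge0_integralD//; last 2 first.
  - by move=> w _; apply: sume_ge0 => k _; rewrite lee_fin mulr_ge0 ?sqr_ge0 ?ltW.
  - move=> w _; apply: sume_ge0 => k _.
    by rewrite patchE; case: ifP => // _; rewrite lee_fin normr_ge0.
  rewrite ge0_integral_sum//; last first.
    by move=> k w _; rewrite lee_fin mulr_ge0 ?sqr_ge0 ?ltW.
  rewrite ge0_integral_sum//; last first.
    move=> k w _.
    by rewrite patchE; case: ifP => // _; rewrite lee_fin normr_ge0.
  rewrite EFinD leeD//.
    rewrite (eq_bigr (fun=> (e * s ^+ 2)%:E)).
      by rewrite sumEFin sumr_const card_ord lee_fin -[leLHS]mulr_natl [leLHS]mulrCA.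
    move=> k _; rewrite ge0_integralZl//.
    - by rewrite (gaussian_second_moment s0 (gaussian s0)).
    - by apply/measurable_EFinP; apply: measurable_funX; exact: measurable_funP.
    - by move=> w _; rewrite lee_fin sqr_ge0.
    - by rewrite lee_fin ltW.
  apply: (@le_trans _ _ (\sum_(k < d) (C * M)%:E)%E).
    apply: lee_sum => k _; rewrite -integral_mkcond; exact: tail.
  by rewrite sumEFin sumr_const card_ord lee_fin mulr_natl.
have E : ((gaussian_rem s)%:E = \int[P s]_w ((g (rvec (eps s) w))%:E
    - (q (rvec (eps s) w))%:E))%E.
  rewrite integralB// Eq (gaussian_remE st) -EFinB; congr EFin.
  by rewrite addrAC subrr add0r.
rewrite -lee_fin; apply: le_trans int_bound.
rewrite -abse_EFin E; apply: le_abse_integral => //.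
exact: measurable_int (integrable_diff st).
Qed.

Lemma cvg_gaussian_rem :
  (gaussian_rem s / s ^+ 2) @[s --> (0 : R)^'+] --> (0 : R).
Proof.
apply/cvgrPdist_le => e e0.
(* Half of [e] pays for the Taylor error, since [d * e1 <= e / 2], and half for the slabs, through
   [L]. The added 1 keeps both divisors positive. The radius is fixed before [s] tends to 0. *)
pose e1 := e / 2 / (d%:R + 1).
have d1 : 0 < d%:R + 1 :> R by rewrite ltr_wpDl.
have e10 : 0 < e1 by rewrite !divr_gt0.
have [r0 r00 Hr0] := peano e10.
pose r := r0 / 2.
have r_gt0 : 0 < r by rewrite divr_gt0.
have Hr x : `|x| < 2 * r -> `|g x - q x| <= e1 * `|x| ^+ 2.
  by move=> xr; apply: Hr0; rewrite (lt_le_trans xr)// /r mulrC divfK.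
pose L := d%:R * M + 1.
have M0 : 0 <= M.
  by apply: fine_ge0; apply: integral_ge0 => w _; rewrite lee_fin normr_ge0.
have L0 : 0 < L by rewrite ltr_wpDl// mulr_ge0.
have e2 : 0 < e / 2 / L by rewrite !divr_gt0.
have /cvgrPdist_le/(_ _ e2) tail := @cvg_tail_factor R d t r t_gt0 r_gt0.
near=> s.
have s0 : 0 < s by near: s; exact: nbhs_right_gt.
have st : 0 < s <= t by rewrite s0/=; near: s; exact: nbhs_right_le.
have s2 : 0 < s ^+ 2 by rewrite exprn_gt0.
have T : `|0 - (t / s) ^+ d * expR (- (r ^+ 2 / 2 * (s ^- 2 - t ^- 2))) / s ^+ 2|
    <= e / 2 / L by near: s; exact: tail.
rewrite sub0r normrN normrM normfV (gtr0_norm s2).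
have := gaussian_rem_le e10 r_gt0 Hr st.
set C := (t / s) ^+ d * _ in T *.
have C0 : 0 <= C by rewrite mulr_ge0 ?expR_ge0// exprn_ge0// divr_ge0 ?ltW.
move: T; rewrite sub0r normrN [`|C / _|]ger0_norm; last first.
  by rewrite divr_ge0 ?(ltW s2).
rewrite ler_pdivrMr// => T B; rewrite ler_pdivrMr//; apply: le_trans B _.
have -> : e * s ^+ 2 = e / 2 * s ^+ 2 + e / 2 * s ^+ 2 by field.
apply: lerD.
  rewrite mulrA ler_wpM2r ?(ltW s2)// /e1 mulrAC ler_pdivrMr//.
  by rewrite ler_wpM2l ?divr_ge0 ?(ltW e0)// lerDl.
apply: (@le_trans _ _ (L * C)).
  by rewrite mulrCA mulrC ler_wpM2r // /L lerDl.
rewrite -ler_pdivlMl//; apply: le_trans T _.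
by rewrite mulrAC [leRHS]mulrC.
Unshelve. all: by end_near. Qed.

End gaussian_remainder_limit.

(** Higher order means [o(eta^2)], the precision of the Peano form for a squared mismatch of class
    2. Smoothness does not limit growth at infinity, so finiteness of the mean is asked at one scale
    [eta0] and passes to the smaller ones. *)
Theorem theorem1 (R : realType) (d : nat) (f fhat : 'rV[R]_d -> 'rV[R]_d)
    (f_smooth : field_class_C 3 f) (fhat_smooth : field_class_C 3 fhat)
    (u : 'rV[R]_d)
    (disp : measure_display) (Omega : R -> measurableType disp)
    (P : forall eta : R, probability (Omega eta) R)
    (eps : forall eta : R, 'I_d -> {RV (P eta) >-> R})
    (eps_gaussian : forall eta : R, 0 < eta -> isotropic_gaussian (eps eta) eta)
    (eta0 : R) (eta0_gt0 : 0 < eta0)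
    (finite_at_eta0 :
      ('E_(P eta0)[fun w => frob2 (delta_jac f fhat (u + rvec (eps eta0) w)%R)]
         < +oo)%E) :
  exists Rem : R -> R,
    (forall eta : R, 0 < eta <= eta0 ->
      'E_(P eta)[fun w => frob2 (delta_jac f fhat (u + rvec (eps eta) w)%R)]%E =
        (frob2 (delta_jac f fhat u)
         + eta ^+ 2 * frob2_tensor3 (delta_hess f fhat u)
         + eta ^+ 2 * (\sum_(i < d) \sum_(l < d)
             delta_jac f fhat u i l * tr_last2 (delta_third f fhat u) i l)
         + Rem eta)%:E) /\
    (Rem eta / eta ^+ 2) @[eta --> (0 : R)^'+] --> (0 : R).
Proof.
pose G x := frob2 (delta_jac f fhat x).
have CG : class_C 2 G by exact: class_C_frob2.
pose g x := G (u + x).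
have cadd : continuous (fun y : 'rV[R]_d => u + y).
  move=> y; apply: (@continuousD _ _ _ (cst u) id).
    exact: cst_continuous.
  exact: cvg_id.
have cg : continuous g.
  have cG := continuous_class_C CG.
  by move=> x; exact: (cvg_comp _ _ (cadd x) (cG (u + x))).
have g_ge0 x : 0 <= g x.
  by apply: sumr_ge0 => i _; apply: sumr_ge0 => l _; exact: sqr_ge0.
have fin0 : (\int[P eta0]_w (g (rvec (eps eta0) w))%:E < +oo)%E.
  by have := finite_at_eta0; rewrite unlock.
pose b k := partial k G u.
pose H j k := partial j (partial k G) u.
have peano e : 0 < e -> exists2 r : R, 0 < r & forall x, `|x| < r ->
    `|g x - quadratic (G u) b H x| <= e * `|x| ^+ 2.
  exact: taylor2_peano.
(* The remainder is the exact error, so the identity rests on finiteness and on [laplacian_frob2];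
   the analytic content is its limit. *)
exists (gaussian_rem eps g (G u) H); split.
  move=> eta eta_le; rewrite unlock.
  rewrite (gaussian_remE eps_gaussian cg g_ge0 eta0_gt0 fin0 (G u) H eta_le).
  congr (_ + _)%:E.
  by rewrite /H laplacian_frob2// mulrDr addrA.
exact: (cvg_gaussian_rem eps_gaussian cg g_ge0 eta0_gt0 fin0 peano).
Qed.
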